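(* Let $d\ge1$, let $f:\mathbb{T}^d\to[0,1]$ be measurable, and let $p,q\in[0,1]$. Then $\mu_p\preccurlyeq_{\rm f}\mathbb{P}^f$ if and only if $p\le\mathrm{HM}(f)$. Similarly, $\mathbb{P}^f\preccurlyeq_{\rm f}\mu_q$ if and only if $q\ge 1-\mathrm{HM}(\mathbf 1-f)$.
   Context: $\mathbb{T}^d:=\mathbb{R}^d/\mathbb{Z}^d$ with unit Lebesgue measure $\lambda_d$; $\widehat f(k):=\int_{\mathbb{T}^d} f(x)e^{-2\pi i k\cdot x}\,d\lambda_d(x)$. For measurable $f:\mathbb{T}^d\to[0,1]$, $\mathbb{P}^f$ is the unique Borel probability measure on $\{0,1\}^{\mathbb{Z}^d}$ such that for all $k\ge1$ and all distinct $e_1,\dots,e_k\in\mathbb{Z}^d$, $\mathbb{P}^f[\eta(e_1)=1,\dots,\eta(e_k)=1]=\det[\widehat f(e_j-e_i)]_{1\le i,j\le k}$ (it exists and is translation invariant). The harmonic mean is $\mathrm{HM}(f):=\left(\int_{\mathbb{T}^d}\frac{d\lambda_d}{f}\right)^{-1}$ (so $\mathrm{HM}(f)=0$ iff $1/f$ is not integrable). $\mu_p$ is the product measure on $\{0,1\}^{\mathbb{Z}^d}$ with density $p$ of 1s. $\mathbf 1$ is the constant function 1. Full domination: let $\mathcal{Z}$ be the $\sigma$-field generated by $\eta(k)$ for $k\in\mathbb{Z}^d\setminus\{\mathbf 0\}$. For a stationary process $\{\eta_n\}_{n\in\mathbb{Z}^d}$ with law $\nu$, $\mu_p\preccurlyeq_{\rm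 f}\nu$ means $\nu[\eta_{\mathbf 0}=1\mid\mathcal{Z}]\ge p$ $\nu$-a.s.; $\nu\preccurlyeq_{\rm f}\mu_p$ is defined with $\ge$ replaced by $\le$. *)

(* Defs.v *)
From HB Require Import structures.
From mathcomp Require Import all_boot all_order all_algebra.
From mathcomp Require Import complex.
From mathcomp Require Import all_classical all_reals all_analysis.

Set Implicit Arguments.
Unset Strict Implicit.
Unset Printing Implicit Defensive.
Import Order.TTheory GRing.Theory Num.Theory.
Import numFieldNormedType.Exports.

Local Open Scope classical_set_scope.
Local Open Scope ring_scope.

Section torus.
Context (R : realType).

(* the domain is [measurableTypeR R], not R, because [uniform_prob] is a measure
   on that alias *)
Definition tuple_cons n (xy : measurableTypeR R * n.-tuple R) : n.+1.-tuple R :=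
  [tuple of xy.1 :: xy.2].

Lemma measurable_tuple_cons n : measurable_fun setT (@tuple_cons n).
Proof. exact: (measurable_cons measurable_fst measurable_snd). Qed.

HB.instance Definition _ n :=
  isMeasurableFun.Build _ _ _ _ (@tuple_cons n) (@measurable_tuple_cons n).

(* The torus R^d/Z^d is handled through its fundamental domain [0,1]^d:
   functions on the torus are Z^d-periodic functions on R^d (see
   [Zd_periodic]), and [torus_measure d] is the d-fold product of the uniform
   probability on [0,1], so that integrating a periodic function against it is
   integrating over the torus against the unit Lebesgue measure. *)
Fixpoint torus_measure (d : nat) : probability (d.-tuple R) R :=
  match d return probability (d.-tuple R) R with
  | 0 => \d_ [tuple]
  | n.+1 => distribution
              (uniform_prob (@ltr01 R) \x torus_measure n)%E (@tuple_cons n)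
  end.

Definition Zd_periodic d (f : d.-tuple R -> R) : Prop :=
  forall (x : d.-tuple R) (k : 'rV[int]_d),
    f [tuple tnth x i + (k ord0 i)%:~R | i < d] = f x.

Definition dotZ d (k : 'rV[int]_d) (x : d.-tuple R) : R :=
  \sum_(i < d) (k ord0 i)%:~R * tnth x i.

(* exp (- 2 i pi k.x) split into its real and imaginary parts, as the library
   integrates real-valued functions only *)
Definition fourier_coef d (f : d.-tuple R -> R) (k : 'rV[int]_d) : R[i] :=
  Complex (\int[torus_measure d]_x (f x * cos (2 * pi * dotZ k x)))
          (- \int[torus_measure d]_x (f x * sin (2 * pi * dotZ k x))).

(* The inverse of \bar R satisfies 0^-1 = +oo and +oo^-1 = 0, hence 1/f = +oo
   where f vanishes, and the mean is 0 when 1/f is not integrable. *)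
Definition HM d (f : d.-tuple R -> R) : \bar R :=
  ((\int[torus_measure d]_x ((f x)%:E)^-1)^-1)%E.

End torus.

Section conditional_probability.
Context dT (T : measurableType dT) (R : realType) (P : probability T R).

(* g is a version of P[A | G], for G a sub-sigma-algebra *)
Definition cond_prob_version (A : set T) (G : set (set T)) (g : T -> R) :
    Prop :=
  [/\ forall B : set R, measurable B -> G (g @^-1` B),
      P.-integrable setT (EFin \o g) &
      forall B, G B -> (\int[P]_(x in B) (g x)%:E = P (A `&` B))%E].

End conditional_probability.

(* {0,1}^(Z^d) with its Borel sigma-algebra *)
Definition config_top (d : nat) := prod_topology (fun _ : 'rV[int]_d => bool).

Definition config (d : nat) := g_sigma_algebraType (@open (config_top d)).

Definition occupied d (k : 'rV[int]_d) : set (config d) :=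
  [set eta : config d | eta k = true].

Definition off_origin d : set (set (config d)) :=
  <<s [set A | exists2 k : 'rV[int]_d, k != 0 & A = occupied k] >>.

Section domination.
Context (R : realType) (d : nat).

(* The law P^f is the unique probability satisfying this predicate. *)
Definition is_determinantal (f : d.-tuple R -> R)
    (P : probability (config d) R) : Prop :=
  forall (k : nat) (e : 'I_k -> 'rV[int]_d), (0 < k)%N -> injective e ->
    (fine (P [set eta : config d | forall i, eta (e i) = true]))%:C%C =
    \det (\matrix_(i < k, j < k) fourier_coef f (e j - e i)).

(* Full domination depends on the product measure mu_p only through p. Two
   versions of a conditional probability agree almost surely, so that it does
   not matter which one is compared with p. *)
Definition full_dom_by_product (p : R) (nu : probability (config d) R) : Prop :=
  exists2 g : config d -> R,
    cond_prob_version nu (occupied 0) (@off_origin d) g &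
    {ae nu, forall eta, p <= g eta}.

Definition full_dom_product (nu : probability (config d) R) (q : R) : Prop :=
  exists2 g : config d -> R,
    cond_prob_version nu (occupied 0) (@off_origin d) g &
    {ae nu, forall eta, g eta <= q}.

End domination.

(* Main.v *)
(** Write K for the matrix with entries fhat(e_j - e_i). The probability of a
   cylinder event (sites with prescribed values 1 or 0) is the determinant whose
   row at a site is K_i if the value is 1 and delta_i - K_i if it is 0.
   Domination by mu_p says that P(eta_0 = 1, B) >= p P(B) for all cylinders B
   off the origin; expanding along the row of the origin, the difference is the
   cylinder determinant of K - p E_00, which is nonnegative as soon as
   0 <= K - p E_00 and K <= 1. The quadratic form of K at v is the integral of
   f |S|^2 for the trigonometric sum S with coefficients v, so K >= p E_00 means
   p |int S|^2 <= int f |S|^2, and by Cauchy-Schwarz this holds for p = HM f.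
   Conversely, domination gives p det K_S <= det K_(S + 0), hence all Gram
   determinants are positive, and a Schur complement turns the inequality into
   p |int S|^2 <= int f |S|^2; letting S approximate 1 / (f + 1/n) in L^2 gives
   p int 1 / (f + 1/n) <= 1. Domination of P^f from above is the same statement
   for 1 - f, with the values 0 and 1 exchanged. *)

Require Import Defs.
From HB Require Import structures.
From mathcomp Require Import all_boot all_order all_algebra.
From mathcomp Require Import complex ring lra.
From mathcomp Require Import all_classical all_reals all_analysis.
From mathcomp Require Import measurable_realfun.

Set Implicit Arguments.
Unset Strict Implicit.
Unset Printing Implicit Defensive.
Import Order.TTheory GRing.Theory Num.Theory.
Import numFieldNormedType.Exports.

Local Open Scope classical_set_scope.
Local Open Scope ring_scope.

(** * Determinants of Hermitian matrices *)

(** The cylinder determinants of K - p E_00 are not a priori probabilities, so their sign cannot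
    come from a measure; it is obtained by linear algebra, for Hermitian matrices with some rows
    negated. The same argument gives the Schur complement inequality without dividing by a minor
    that might vanish. Full domination concerns a whole sigma-field, and an inequality between two
    measures is not stable under differences of sets, so the passage from cylinders goes through
    approximation up to sets of small measure. The converse uses only cylinders with all values 1,
    and separates p = 0, where Gram determinants may vanish, from p > 0. Since 1 / f may be infinite
    or non-integrable, Cauchy-Schwarz rests on a pointwise inequality in the extended reals, and L^2
    approximation is applied only to bounded functions. Density is reached through indicators:
    half-spaces are a.e. limits of polynomials in a shifted cosine, such limits are stable under
    intersection, and the sets with L^2-approximable indicator form a lambda-system. *)

Section hermitian.
Context (R : rcfType).
Local Notation C := (complex R).

Lemma conj_real (x : R) : (x%:C%C)^* = x%:C%C.
Proof. exact: conjc_real. Qed.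

Definition self_adjoint n (H : 'M[C]_n) := forall i j, H j i = (H i j)^*.

Definition sform n (H : 'M[C]_n) (u v : 'I_n -> C) : C :=
  \sum_i \sum_j (u i)^* * H i j * v j.

Definition qform n (H : 'M[C]_n) v := sform H v v.

Lemma sformC n (H : 'M[C]_n) u v : self_adjoint H -> sform H v u = (sform H u v)^*.
Proof.
move=> hH; rewrite /sform rmorph_sum exchange_big /=; apply: eq_bigr => i _.
rewrite rmorph_sum; apply: eq_bigr => j _.
rewrite !rmorphM /= conjCK -hH; ring.
Qed.

(** Conjugating all entries of a self-adjoint matrix transposes it, which leaves the determinant
    unchanged. *)
Lemma det_hermitian_real n (H : 'M[C]_n) : self_adjoint H -> \det H \is Num.real.
Proof.
move=> hH; have : \det (map_mx Num.conj H) = \det H.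
  rewrite -[RHS]det_tr; congr (\det _); apply/matrixP => i j.
  by rewrite !mxE -hH.
rewrite det_map_mx /=; case: (\det H) => a b /= /eqP.
rewrite eq_complex /= eqxx /= complex_real -subr_eq0 -opprD oppr_eq0.
by rewrite -mulr2n mulrn_eq0.
Qed.

Definition signed_rows n (b : 'I_n -> bool) (H : 'M[C]_n) : 'M[C]_n :=
  \matrix_(i, j) (if b i then H i j else - H i j).

Lemma signed_rowsE n (b : 'I_n -> bool) (H : 'M[C]_n) :
  signed_rows b H = diag_mx (\row_i (if b i then 1 else -1)) *m H.
Proof.
apply/matrixP => i j; rewrite !mxE (bigD1 i)//= big1 ?addr0.
  by rewrite !mxE eqxx mulr1n; case: ifP => _; rewrite ?mul1r ?mulN1r.
by move=> k ki; rewrite !mxE eq_sym (negbTE ki) mulr0n mul0r.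
Qed.

(* With M = [signed_rows b H], Re (v^* M v) >= 0, so s M + (1 - s) I is
   invertible for s < 1; its determinant is real, hence keeps the sign it has
   at s = 0. *)
Lemma det_signed_rows_ge0 n (b : 'I_n -> bool) (H : 'M[C]_n) :
  self_adjoint H ->
  (forall v, (forall i, ~~ b i -> v i = 0) -> 0 <= qform H v) ->
  (forall v, (forall i, b i -> v i = 0) -> qform H v <= 0) ->
  0 <= \det (signed_rows b H).
Proof.
move=> hH pos neg.
set M := signed_rows b H.
pose P s := (s *: M + (1 - s) *: 1%:M : 'M[C]_n).
(* The sign matrix [J] is an involution, so [P s] is [J] times s H + (1 - s) J, a product of two
   self-adjoint matrices. *)
have detreal (s : R) : \det (P s%:C%C) \is Num.real.
  pose J : 'M[C]_n := diag_mx (\row_i (if b i then 1 else -1)).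
  have JJ : J *m J = 1%:M.
    apply/matrixP => i j; rewrite mul_diag_mx !mxE; case: (altP eqP) => [->|_].
      by case: ifP => _; rewrite !mulr1n ?mulr1// mulrNN mulr1.
    by rewrite !mulr0n mulr0.
  have -> : P s%:C%C = J *m (s%:C%C *: H + (1 - s%:C%C) *: J).
    by rewrite mulmxDr -!scalemxAr JJ /P /M signed_rowsE.
  rewrite det_mulmx; apply: realM.
    rewrite det_diag; apply: rpred_prod => i _; rewrite mxE.
    by case: ifP => _; rewrite ?rpredN ?rpred1.
  have -> : 1 - s%:C%C = (1 - s)%:C%C by rewrite rmorphB rmorph1.
  move: (1 - s) => t.
  have E i j : (s%:C%C *: H + t%:C%C *: J) i j =
      s%:C%C * H i j + t%:C%C * J i j by rewrite mxE [in LHS]mxE [X in _ + X = _]mxE.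
  apply: det_hermitian_real => i j; rewrite !{}E rmorphD /= !rmorphM /= !conj_real -hH.
  congr (_ + _ * _); rewrite !mxE.
  rewrite eq_sym; case: (altP eqP) => [->|_]; last by rewrite !mulr0n rmorph0.
  by rewrite !mulr1n; case: ifP => _; rewrite ?rmorphN rmorph1.
have detneq0 (s : R) : 0 <= s -> s < 1 -> \det (P s%:C%C) != 0.
  (* Adding the equation to its conjugate removes the cross terms: [x] and [y] are conjugate, so
     their difference is purely imaginary. *)
  have re_part (t a x y c e : C) : t^* = t -> a^* = a -> x^* = y -> c^* = c ->
      e^* = e -> t * (a + x - y - c) + (1 - t) * e = 0 ->
      2%:R * (t * (a - c) + (1 - t) * e) = 0.
    move=> tt aa xy cc ee E; have := congr1 Num.conj E.
    rewrite !(rmorphD, rmorphM, rmorphB, rmorphN, rmorph1, rmorph0) /=.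
    rewrite tt aa -xy cc ee conjCK => E'; rewrite -[RHS]addr0 -[in X in _ = X + _]E -E' -xy; ring.
  (* [det0P] produces a row vector killed from the left; after transposition it is a kernel vector
     of [P s] itself. *)
  move=> s0 s1; rewrite -det_tr; apply/negP => /det0P [w w0 wP].
  pose v i := w 0 i.
  pose v1 i := if b i then v i else 0.
  pose v2 i := if b i then 0 else v i.
  have q1 : 0 <= qform H v1 by apply: pos => i bi; rewrite /v1 (negbTE bi).
  have q2 : qform H v2 <= 0 by apply: neg => i bi; rewrite /v2 bi.
  have E : s%:C%C * (sform H v1 v1 + sform H v1 v2 - sform H v2 v1 - sform H v2 v2)
    + (1 - s%:C%C) * (\sum_i `|v i| ^+ 2) = 0.
    have : \sum_i (v i)^* * (w *m (P s%:C%C)^T) 0 i = 0.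
      by apply: big1 => i _; rewrite wP mxE mulr0.
    move=> E0; rewrite -[RHS]E0 /sform -big_split /= -sumrB -sumrB !mulr_sumr -big_split /=.
    apply: eq_bigr => i _.
    rewrite mxE.
    have -> : \sum_j w 0 j * (P s%:C%C)^T j i =
      s%:C%C * (\sum_j (if b i then H i j else - H i j) * v j) + (1 - s%:C%C) * v i.
      transitivity (\sum_j (s%:C%C * ((if b i then H i j else - H i j) * v j) +
         (1 - s%:C%C) * (v j * (i == j)%:R))).
        by apply: eq_bigr => j _; rewrite !mxE /v; ring.
      rewrite big_split -!mulr_sumr; congr (_ + _ * _).
      rewrite (bigD1 i)//= eqxx mulr1 big1 ?addr0// => j ji.
      by rewrite eq_sym (negbTE ji) mulr0.
    rewrite [RHS]mulrDr; congr (_ + _); last by rewrite normCK; ring.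
    rewrite [RHS]mulrCA; congr (_ * _).
    rewrite -big_split -!sumrB mulr_sumr; apply: eq_bigr => j _ /=.
    rewrite /v1 /v2; case: (b i); case: (b j); rewrite ?rmorph0; ring.
  have E2 : 2%:R * (s%:C%C * (sform H v1 v1 - sform H v2 v2)
    + (1 - s%:C%C) * (\sum_i `|v i| ^+ 2)) = 0.
    apply: (@re_part _ _ (sform H v1 v2) (sform H v2 v1)); rewrite -?sformC ?conj_real//.
    by rewrite rmorph_sum; apply: eq_bigr => i _; rewrite /= normCK rmorphM /= conjCK mulrC.
  have v0 : \sum_i `|v i| ^+ 2 = 0.
    apply/eqP; rewrite eq_le sumr_ge0 ?andbT; last by move=> i _; rewrite exprn_ge0.
    move/eqP: E2; rewrite mulf_eq0 pnatr_eq0/= addr_eq0 => /eqP E2.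
    have s1' : 0 < 1 - s%:C%C :> C by rewrite subr_gt0 ltcR.
    rewrite -(pmulr_rle0 _ s1') -oppr_ge0 -E2 mulr_ge0 ?lecR//.
    by rewrite subr_ge0 (le_trans q2).
  move/negP: w0; apply; apply/eqP/rowP => i; rewrite mxE.
  move/eqP: v0; rewrite psumr_eq0; last by move=> k _; rewrite exprn_ge0.
  by move=> /allP/(_ i); rewrite mem_index_enum sqrf_eq0 normr_eq0 => /(_ isT)/eqP.
(* Over a real closed field the intermediate value theorem is available for polynomials, so the
   determinant is made a polynomial in s; [q] keeps the real parts of its coefficients. *)
pose Q : 'M[{poly C}]_n := 'X *: map_mx polyC M + (1 - 'X) *: 1%:M.
have QE (s : C) : (\det Q).[s] = \det (P s).
  rewrite -horner_evalE -det_map_mx; congr (\det _); apply/matrixP => i j.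
  by rewrite !mxE /= /horner_eval !(hornerE, hornerMn).
pose q : {poly R} := \poly_(i < size (\det Q)) complex.Re (\det Q)`_i.
have qE (s : R) : q.[s] = complex.Re (\det (P s%:C%C)).
  rewrite horner_poly -QE horner_coef.
  rewrite (big_morph (@complex.Re R) (id1 := 0) (op1 := +%R))//; last by case=> ? ? [].
  apply: eq_bigr => i _.
  by rewrite -rmorphXn; case: (_`_i) => x y /=; rewrite mulr0 subr0.
have P0 : P 0%:C%C = 1%:M by rewrite /P scale0r subr0 scale1r add0r.
have P1 : P 1%:C%C = M by rewrite /P subrr scale0r addr0 scale1r.
have [q1|q1] := leP 0 q.[1].
  move: q1; rewrite qE P1 -ler0c RRe_real//.
  by rewrite -P1; exact: detreal.
have [|s /andP[s0 s1] /eqP qs] := @poly_ivt _ (- q) 0 1 ler01.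
  by rewrite !hornerN oppr_ge0 oppr_le0 (ltW q1) qE P0 det1 ler01.
have s1' : s < 1.
  rewrite lt_neqAle s1 andbT; apply/eqP => s1'.
  by move: q1; rewrite -s1' -oppr_gt0 -hornerN qs ltxx.
move: (detneq0 _ s0 s1'); rewrite -(RRe_real (detreal s)) -qE.
by move/eqP: qs; rewrite hornerN oppr_eq0 => /eqP ->; rewrite eqxx.
Qed.

(** Multilinearity in row [i0]; a row equal to a basis vector leaves the principal minor, its
    cofactor sign being an even power of -1. This serves the removal of p E_00, the Schur complement
    and inclusion-exclusion. *)
Lemma det_add_delta n (i0 : 'I_n.+1) (A B : 'M[C]_n.+1) (c a : C) :
  (forall i j, i != i0 -> B i j = A i j) ->
  (forall j, B i0 j = c * A i0 j + a * (i0 == j)%:R) ->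
  \det B = c * \det A + a * \det (row' i0 (col' i0 A)).
Proof.
move=> h1 h2.
pose D : 'M[C]_n.+1 := \matrix_(i, j) if i == i0 then (i0 == j)%:R else A i j.
have -> : \det (row' i0 (col' i0 A)) = \det D.
  rewrite (expand_det_row D i0) (bigD1 i0)//= big1; last first.
    by move=> j j0; rewrite mxE eqxx eq_sym (negbTE j0) mul0r.
  rewrite mxE !eqxx mul1r addr0 /cofactor addnn -signr_odd odd_double expr0 mul1r.
  congr (\det _).
  by apply/matrixP => i j; rewrite !mxE eq_sym (negbTE (neq_lift _ _)).
apply: (determinant_multilinear (i0 := i0)).
- by apply/rowP => j; rewrite !mxE eqxx h2.
- by apply/matrixP => i j; rewrite !mxE h1// eq_sym neq_lift.
- apply/matrixP => i j; rewrite !mxE h1 1?eq_sym ?neq_lift//.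
  by rewrite (negbTE (neq_lift _ _)).
Qed.

Definition cyl_mx n (b : 'I_n -> bool) (K : 'M[C]_n) : 'M[C]_n :=
  \matrix_(i, j) (if b i then K i j else (i == j)%:R - K i j).

(** Let H be K minus the identity on the sites with value 0. It is nonnegative on vectors supported
    by the 1-sites, as K >= 0, and nonpositive on those supported by the 0-sites, as K <= 1; the
    cylinder matrix is H with the 0-rows negated. *)
Lemma det_cyl_mx_ge0 n (b : 'I_n -> bool) (K : 'M[C]_n) :
  self_adjoint K ->
  (forall v, 0 <= qform K v) ->
  (forall v, qform K v <= \sum_i `|v i| ^+ 2) ->
  0 <= \det (cyl_mx b K).
Proof.
move=> hK K0 K1.
pose H : 'M[C]_n := \matrix_(i, j) (K i j - ((i == j) && ~~ b i)%:R).
have qH v : qform H v = qform K v - \sum_(i | ~~ b i) `|v i| ^+ 2.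
  rewrite [X in _ - X]big_mkcond /= -sumrB; apply: eq_bigr => i _.
  transitivity (\sum_j ((v i)^* * K i j * v j -
      (v i)^* * v j * ((i == j) && ~~ b i)%:R)).
    by apply: eq_bigr => j _; rewrite !mxE; ring.
  rewrite sumrB [X in _ - X](bigD1 i)//= eqxx.
  rewrite [X in _ - (_ + X)]big1 ?addr0; last first.
    by move=> j ji; rewrite eq_sym (negbTE ji) mulr0.
  by congr (_ - _); case: (b i); rewrite /= ?mulr0 ?mulr1// normCK mulrC.
have -> : cyl_mx b K = signed_rows b H.
  apply/matrixP => i j; rewrite !mxE.
  by case: (b i); rewrite ?andbF ?subr0// andbT opprB.
apply: det_signed_rows_ge0.
- move=> i j; rewrite !mxE rmorphB /= -hK rmorph_nat; congr (_ - _%:R).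
  by rewrite eq_sym; case: eqVneq => [->|].
- move=> v hv; rewrite qH big1 ?subr0// => i bi.
  by rewrite hv// normr0 expr0n.
- move=> v hv; rewrite qH subr_le0 (le_trans (K1 v))//.
  rewrite [leRHS]big_mkcond ler_sum// => i _.
  by case: ifPn => // /negPn /hv ->; rewrite normr0 expr0n.
Qed.

Lemma det_cyl_mx_step n (b : 'I_n.+1 -> bool) (K : 'M[C]_n.+1) (p : R) :
  self_adjoint K -> b ord0 -> 0 <= p ->
  (forall v, p%:C%C * `|v ord0| ^+ 2 <= qform K v) ->
  (forall v, qform K v <= \sum_i `|v i| ^+ 2) ->
  p%:C%C * \det (cyl_mx (b \o lift ord0) (row' ord0 (col' ord0 K))) <=
  \det (cyl_mx b K).
Proof.
move=> hK b0 p0 K0 K1.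
pose K' : 'M[C]_n.+1 := \matrix_(i, j) (K i j - p%:C%C * ((i == ord0) && (j == ord0))%:R).
have qK' v : qform K' v = qform K v - p%:C%C * `|v ord0| ^+ 2.
  rewrite {1}/qform /sform (eq_bigr (fun i => \sum_j (v i)^* * K i j * v j -
      (i == ord0)%:R * (p%:C%C * `|v ord0| ^+ 2))); last first.
    move=> i _; rewrite normCK.
    rewrite (eq_bigr (fun j => (v i)^* * K i j * v j - (j == ord0)%:R * (
       (i == ord0)%:R * (v i)^* * p%:C%C * v ord0))).
      rewrite sumrB [X in _ - X](bigD1 ord0)//= [X in _ - (_ + X)]big1.
        by rewrite ?eqxx; case: eqVneq => [->|_]; rewrite /= ?mul0r ?mulr0; ring.
      by move=> j /negbTE ->; rewrite mul0r.
    move=> j _; rewrite mxE; case: (altP (j =P _)) => [->|_].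
      by case: (i == ord0) => /=; ring.
    by case: (i == ord0) => /=; ring.
  rewrite sumrB; congr (_ - _).
  rewrite (bigD1 ord0)//= big1 ?addr0 ?eqxx ?mul1r//.
  by move=> j /negbTE ->; rewrite mul0r.
rewrite -subr_ge0.
have -> : \det (cyl_mx b K) - p%:C%C *
    \det (cyl_mx (b \o lift ord0) (row' ord0 (col' ord0 K))) = \det (cyl_mx b K').
  rewrite (@det_add_delta _ ord0 (cyl_mx b K) (cyl_mx b K') 1 (- p%:C%C)).
  - rewrite mul1r mulNr; congr (_ - _ * \det _).
    by apply/matrixP => i j; rewrite !mxE /= (inj_eq lift_inj).
  - by move=> i j /negbTE i0; rewrite !mxE i0 /= mulr0 subr0.
  - by move=> j; rewrite !mxE b0 eqxx /= (eq_sym j); ring.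
apply: det_cyl_mx_ge0.
- move=> i j; rewrite !mxE rmorphB /= -hK rmorphM /= conj_real rmorph_nat.
  by rewrite andbC.
- by move=> v; rewrite qK' subr_ge0.
- move=> v; rewrite qK' (le_trans _ (K1 v))// gerBl mulr_ge0 ?exprn_ge0//.
  by rewrite lecR.
Qed.

Lemma qform_mulmx n (H : 'M[C]_n) v :
  qform H v = ((map_mx Num.conj (\col_i v i))^T *m H *m \col_i v i) ord0 ord0.
Proof.
rewrite !mxE /qform /sform exchange_big; apply: eq_bigr => j _ /=.
by rewrite !mxE mulr_suml; apply: eq_bigr => i _; rewrite !mxE.
Qed.

(* Schur complement: after the change of basis replacing the first vector by
   [v], removing the entry [qform K v] leaves a form that is nonnegative on one
   block and zero on the other. *)
Lemma det_le_qform n (K : 'M[C]_n.+1) v :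
  self_adjoint K -> (forall u, 0 <= qform K u) -> v ord0 = 1 ->
  \det K <= qform K v * \det (row' ord0 (col' ord0 K)).
Proof.
move=> hK K0 v0.
pose A : 'M[C]_n.+1 := \matrix_(i, j) if j == ord0 then v i else (i == j)%:R.
pose H := (map_mx Num.conj A)^T *m K *m A.
have detA : \det A = 1.
  rewrite det_trig; last first.
    apply/is_trig_mxP => i j ij; rewrite mxE.
    have j0 : j != ord0 by apply: contraTneq ij => ->.
    by rewrite (negbTE j0); case: eqVneq ij => // ->; rewrite ltnn.
  apply: big1 => i _; rewrite mxE eqxx; case: eqVneq => // ->; exact: v0.
have detH : \det H = \det K.
  by rewrite !det_mulmx det_tr det_map_mx detA rmorph1 mul1r mulr1.
have AE i : i != ord0 -> forall k, A k i = (k == i)%:R.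
  by move=> i0 k; rewrite mxE (negbTE i0).
have HE i j : H i j = \sum_k (\sum_l (A l i)^* * K l k) * A k j.
  rewrite mxE; apply: eq_bigr => k _; congr (_ * _); rewrite mxE.
  by apply: eq_bigr => l _; rewrite !mxE.
have H00 : H ord0 ord0 = qform K v.
  rewrite HE /qform /sform exchange_big; apply: eq_bigr => k _ /=.
  by rewrite mulr_suml; apply: eq_bigr => l _; rewrite !mxE.
have Hij i j : i != ord0 -> j != ord0 -> H i j = K i j.
  move=> i0 j0; rewrite HE (bigD1 j)//= [X in _ + X]big1 ?addr0; last first.
    by move=> k kj; rewrite AE// (negbTE kj) mulr0.
  rewrite AE// eqxx mulr1 (bigD1 i)//= big1 ?addr0; last first.
    by move=> k kj; rewrite AE// (negbTE kj) rmorph0 mul0r.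
  by rewrite AE// eqxx rmorph1 mul1r.
have hH : self_adjoint H.
  move=> i j; rewrite !HE rmorph_sum /=.
  under eq_bigr do rewrite mulr_suml.
  rewrite exchange_big; apply: eq_bigr => k _ /=.
  rewrite rmorphM rmorph_sum /= mulr_suml; apply: eq_bigr => l _.
  by rewrite rmorphM /= conjCK -hK; ring.
have qH u : qform H u = qform K (fun i => \sum_j A i j * u j).
  rewrite !qform_mulmx.
  have -> : \col_i (\sum_j A i j * u j) = A *m \col_i u i.
    apply/colP => i; rewrite [LHS]mxE [RHS]mxE; apply: eq_bigr => j _.
    by congr (_ * _); rewrite mxE.
  by rewrite map_mxM trmx_mul !mulmxA.
pose H' : 'M[C]_n.+1 := \matrix_(i, j) (H i j - qform K v * ((i == ord0) && (j == ord0))%:R).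
have qreal : (qform K v)^* = qform K v by rewrite /qform -sformC.
have H'E i j : ~~ ((i == ord0) && (j == ord0)) -> H' i j = H i j.
  by move=> /negbTE ij; rewrite mxE ij mulr0 subr0.
(* Negating row 0 of [H'] gives the row -H_0 + (qform K v) e_0, so expansion yields [qform K v]
   times the minor, minus the determinant of K. *)
have : 0 <= \det (signed_rows (fun i => i != ord0) H').
  apply: det_signed_rows_ge0.
  - move=> i j; rewrite [LHS]mxE [X in _ = X^*]mxE rmorphB /= -hH rmorphM /= qreal rmorph_nat.
    by rewrite andbC.
  - move=> u /(_ ord0); rewrite eqxx => /(_ isT) u0.
    have -> : qform H' u = qform H u; last by rewrite qH.
    apply: eq_bigr => i _; apply: eq_bigr => j _.
    case: (boolP ((i == ord0) && (j == ord0))) => [/andP[_ /eqP ->]|ij].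
      by rewrite u0 !mulr0.
    by rewrite H'E.
  - move=> u u0; rewrite /qform /sform big1// => i _; rewrite big1// => j _.
    have [i0|i0] := eqVneq i ord0; last by rewrite u0// rmorph0 !mul0r.
    have [j0|j0] := eqVneq j ord0; last by rewrite (u0 j)// mulr0.
    by rewrite i0 j0 mxE eqxx H00 mulr1 subrr mulr0 mul0r.
rewrite (@det_add_delta _ ord0 H _ (-1) (qform K v)).
- rewrite mulN1r detH addrC subr_ge0 => /le_trans; apply.
  rewrite le_eqVlt; apply/orP; left; apply/eqP; congr (_ * \det _).
  by apply/matrixP => i j; rewrite !mxE -Hij ?mxE// eq_sym neq_lift.
- by move=> i j i0; rewrite mxE i0 H'E// (negbTE i0).
- by move=> j; rewrite [LHS]mxE eqxx /= [X in - X]mxE eqxx /= (eq_sym j); ring.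
Qed.

End hermitian.

(** * Cylinders and conditional probabilities *)

Section cylinders.
Context (d : nat).

Lemma measurable_occupied (k : 'rV[int]_d) : measurable (occupied k).
Proof.
apply: sub_sigma_algebra.
rewrite -[occupied k]/((fun eta : config_top d => eta k) @^-1` [set true]).
apply: open_comp; last exact: discrete_open.
by move=> eta _; exact: proj_continuous.
Qed.

Definition cylinder n (e : 'I_n -> 'rV[int]_d) (b : 'I_n -> bool) : set (config d) :=
  [set eta : config d | forall i, eta (e i) = b i].

Lemma cylinder_sigma (G : set (set (config d))) n (e : 'I_n -> 'rV[int]_d) b :
  (forall i, <<s G >> (occupied (e i))) -> <<s G >> (cylinder e b).
Proof.
move=> Ge; pose TG := g_sigma_algebraType G.
have mA i : measurable ([set eta | eta (e i) = b i] : set TG).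
  case: (b i); first exact: Ge.
  have -> : [set eta : TG | eta (e i) = false] = ~` (occupied (e i)).
    by apply/seteqP; split=> eta; rewrite /occupied /=; [move=> -> | move/negP/negbTE].
  by apply: measurableC; exact: Ge.
have -> : cylinder e b = \bigcap_(i in [set: 'I_n]) [set eta | eta (e i) = b i].
  by apply/seteqP; split=> [eta h i _|eta h i]; apply: h.
exact: (@fin_bigcap_measurable _ TG).
Qed.

End cylinders.

(** Radon-Nikodym on the target space: P restricted to [A] and pushed forward by [X] is absolutely
    continuous with respect to the law of [X], and its density composed with [X] is the conditional
    probability. *)
Lemma ex_cond_prob_mfun (R : realType) d1 d2 (T1 : measurableType d1)
    (T2 : measurableType d2) (P : probability T1 R) (X : {mfun T1 >-> T2}) (A : set T1) :
  measurable A ->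
  exists g : T2 -> R, [/\ measurable_fun setT g,
    P.-integrable setT (EFin \o (g \o X)) &
    forall B, measurable B ->
      (\int[P]_(x in X @^-1` B) (g (X x))%:E = P (A `&` X @^-1` B))%E].
Proof.
move=> mA.
have mX : measurable_fun setT X by [].
pose mu := distribution P X.
pose push := (pushforward (charge_of_finite_measure (mrestr P mA)) X : {charge set T2 -> \bar R}).
pose nu := push mX.
have mXV B : measurable B -> measurable (X @^-1` B).
  by move=> mB; rewrite -[X in measurable X]setTI; exact: (mX measurableT).
have numu : nu `<< mu.
  apply/null_content_dominatesP => B mB muB.
  have PB : (P (X @^-1` B `&` A) <= P (X @^-1` B))%E.
    by apply: le_measure; rewrite ?inE//; [apply: measurableI => //|]; exact: mXV.
  apply/eqP; rewrite eq_le; apply/andP; split; last exact: measure_ge0.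
  by rewrite -muB.
pose h := Radon_Nikodym nu mu.
have hfin x : h x \is a fin_num by exact: Radon_Nikodym_fin_num.
have hint : mu.-integrable setT h by exact: Radon_Nikodym_integrable.
have mh : measurable_fun setT h by exact: measurable_int hint.
have hfine : EFin \o (fine \o h \o X) = h \o X.
  by apply/funext => x /=; rewrite fineK.
have hP : P.-integrable setT (h \o X).
  apply/integrableP; split; first exact: measurableT_comp.
  move/integrableP : hint => [_]; apply: le_lt_trans.
  by rewrite ge0_integral_distribution//; exact: measurableT_comp.
exists (fine \o h); split.
- exact: (measurableT_comp (fine_measurable measurableT)).
- by rewrite -[X in _.-integrable _ X]/(EFin \o (fine \o h \o X)) hfine.
- move=> B mB.
  have -> : P (A `&` X @^-1` B) = nu B by rewrite /= /push /pushforward/= /mrestr setIC.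
  rewrite (Radon_Nikodym_integral numu)// integral_pushforward//.
    by apply: eq_integral => x _ /=; rewrite fineK.
  by apply: (integrableS measurableT) => //; exact: mXV.
Qed.

(** Conditioning on a sub-sigma-algebra is conditioning on the identity map into the same set
    carrying the smaller sigma-algebra. *)
Lemma ex_cond_prob_version (R : realType) dT (T : measurableType dT)
    (P : probability T R) (A : set T) (G : set (set T)) :
  measurable A -> (forall B, G B -> measurable B) ->
  exists g, cond_prob_version P A <<s G >> g.
Proof.
move=> mA mG; pose TG := g_sigma_algebraType G.
have mX : measurable_fun [set: T] (idfun : T -> TG).
  move=> _ B mB; rewrite setTI preimage_id.
  move: B mB; apply: smallest_sub => //; exact: sigma_algebra_measurable.
pose X : {mfun T >-> TG} := HB.pack (idfun : T -> TG) (isMeasurableFun.Build _ _ _ _ _ mX).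
have [g [mg gint gE]] := ex_cond_prob_mfun P X mA.
exists g; split => //.
by move=> B mB; rewrite -[X in _ X]setTI; exact: mg.
Qed.

(** * Approximation of a generated sigma-algebra by an algebra of sets *)

Section approximation.
Context dT (T : measurableType dT) (R : realType) (P : {finite_measure set T -> \bar R}).
Variable (G : set (set T)).
Hypotheses (GI : setI_closed G) (GC : forall A, G A -> G (~` A)) (GT : G setT)
  (mG : forall A, G A -> measurable A).

Let approximable (B : set T) := measurable B /\ forall e : R, 0 < e ->
  exists C, [/\ G C, (P (B `\` C) < e%:E)%E & (P (C `\` B) < e%:E)%E].

Let P_le_U2 A B C (e : R) : measurable A -> measurable B -> measurable C ->
  A `<=` B `|` C -> (P B < (e / 2)%:E)%E -> (P C < (e / 2)%:E)%E -> (P A < e%:E)%E.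
Proof.
move=> mA mB mC ABC PB PC; apply: (@le_lt_trans _ _ (P B + P C)%E).
  apply: le_trans (measureU2 _ mB mC).
  by rewrite le_measure ?inE//; exact: measurableU.
by rewrite (splitr e) EFinD lteD.
Qed.

(** The approximable sets form a lambda-system containing [G]. For an increasing union, continuity
    from above of the finite measure selects one term close to the union, and that term is then
    approximated. *)
Lemma generated_approx B : <<s G >> B -> forall e : R, 0 < e ->
  exists C, [/\ G C, (P (B `\` C) < e%:E)%E & (P (C `\` B) < e%:E)%E].
Proof.
move=> GB; suff : approximable B by case.
move: B GB; apply: lambda_system_subset => //; last first.
  move=> B GB; split; first exact: mG.
  by move=> e e0; exists B; rewrite setDv measure0 lte_fin.
split => //.
- split => // e e0; exists setT; rewrite setDv measure0 lte_fin.
  by split.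
- move=> A B BA [mA aA] [mB aB]; split; first exact: measurableD.
  move=> e e0; have e20 : 0 < e / 2 by rewrite divr_gt0.
  have [C [GC' AC CA]] := aA _ e20; have [D [GD BD DB]] := aB _ e20.
  have mC := mG GC'; have mD := mG GD.
  exists (C `\` D); split.
  + by rewrite setDE; apply: GI => //; exact: GC.
  + apply: (@P_le_U2 _ (A `\` C) (D `\` B)) => //; try exact: measurableD.
    * by apply: measurableD; exact: measurableD.
    * move=> x [[Ax nBx] nCDx]; have [Cx|Cx] := pselect (C x); last by left.
      right; split => //; apply: contrapT => nDx; exact: nCDx.
  + apply: (@P_le_U2 _ (C `\` A) (B `\` D)) => //; try exact: measurableD.
    * by apply: measurableD; exact: measurableD.
    * move=> x [[Cx nDx] nABx]; have [Ax|Ax] := pselect (A x); last by left.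
      right; split => //; apply: contrapT => nBx; exact: nABx.
- move=> F ndF aF; have mF i : measurable (F i) by have [] := aF i.
  have mUF : measurable (\bigcup_i F i) by exact: bigcupT_measurable.
  split => // e e0; have e20 : 0 < e / 2 by rewrite divr_gt0.
  have [n Fn] : exists n, (P (\bigcup_i F i `\` F n) < (e / 2)%:E)%E.
    have cvgF : P \o (fun n => \bigcup_i F i `\` F n) @ \oo --> 0%E.
      rewrite -(measure0 P).
      have -> : set0 = \bigcap_n (\bigcup_i F i `\` F n).
        apply/esym; rewrite -subset0 => x xF.
        have [[i _ Fix] _] := xF 0%N I.
        by have [_] := xF i I; apply.
      apply: nonincreasing_cvg_mu.
      - by rewrite ltey_eq fin_num_measure//; exact: measurableD.
      - by move=> i; exact: measurableD.
      - by apply: bigcapT_measurable => i; exact: measurableD.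
      - by move=> i j ij; apply/subsetPset; apply: setDS; apply/subsetPset; exact: ndF.
    have : \forall n \near \oo, ((P \o (fun n => \bigcup_i F i `\` F n)) n < (e / 2)%:E)%E.
      apply: (cvgF [set y | (y < (e / 2)%:E)%E]); apply: open_nbhs_nbhs; split.
        exact: open_ereal_lt_ereal.
      by rewrite /= lte_fin.
    by case=> N _ /(_ N (leqnn N)) /= ?; exists N.
  have [_ /(_ _ e20) [C [GC' FC CF]]] := aF n.
  have mC := mG GC'.
  exists C; split => //.
  + apply: (@P_le_U2 _ (\bigcup_i F i `\` F n) (F n `\` C)) => //; try exact: measurableD.
    by move=> x [Fx nCx]; have [Fnx|Fnx] := pselect (F n x); [right|left].
  + apply: (@le_lt_trans _ _ (P (C `\` F n))).
      rewrite le_measure ?inE//; try exact: measurableD.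
      by move=> x [Cx nFx]; split => // Fnx; apply: nFx; exists n.
    by rewrite (lt_le_trans CF)// lee_fin ler_pdivrMr// mulr_natr mulr2n lerDl ltW.
Qed.

(** The inequality does not pass to differences of sets, so a direct pi-lambda argument fails.
    Domination of both measures by [P] makes the [P]-small error sets small for each of them. *)
Lemma le_measure_generated (m1 m2 : {measure set T -> \bar R}) :
  (forall A, measurable A -> (m1 A <= P A)%E) ->
  (forall A, measurable A -> (m2 A <= P A)%E) ->
  (forall A, G A -> (m1 A <= m2 A)%E) ->
  forall B, <<s G >> B -> (m1 B <= m2 B)%E.
Proof.
move=> m1P m2P m12 B GB; apply/lee_addgt0Pr => e e0.
have e20 : 0 < e / 2 by rewrite divr_gt0.
have [C [GC' BC CB]] := generated_approx GB e20.
have mB : measurable B.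
  by move: B GB {BC CB}; apply: smallest_sub => //; exact: sigma_algebra_measurable.
have mC := mG GC'.
have mBC : measurable (B `\` C) by exact: measurableD.
have mCB : measurable (C `\` B) by exact: measurableD.
rewrite (splitr e) EFinD addeA.
apply: (@le_trans _ _ (m1 C + m1 (B `\` C))%E).
  apply: le_trans (measureU2 _ mC mBC).
  rewrite le_measure ?inE//; first exact: measurableU.
  by move=> x Bx; have [Cx|Cx] := pselect (C x); [left|right].
apply: leeD; last exact: le_trans (m1P _ mBC) (ltW BC).
apply: (le_trans (m12 _ GC')).
apply: (@le_trans _ _ (m2 B + m2 (C `\` B))%E).
  apply: le_trans (measureU2 _ mB mCB).
  rewrite le_measure ?inE//; first exact: measurableU.
  by move=> x Cx; have [Bx|Bx] := pselect (B x); [left|right].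
by apply: leeD => //; exact: le_trans (m2P _ mCB) (ltW CB).
Qed.

End approximation.

(** On the set where g2 < g1 the positive function g1 - g2 has integral at most 0, so that set is
    null. *)
Lemma ae_le_of_integral dT (T : measurableType dT) (R : realType)
    (P : {measure set T -> \bar R}) (g1 g2 : T -> R) :
  P.-integrable setT (EFin \o g1) -> P.-integrable setT (EFin \o g2) ->
  (\int[P]_(x in [set x | (g2 x < g1 x)%R]) (g1 x)%:E <=
   \int[P]_(x in [set x | (g2 x < g1 x)%R]) (g2 x)%:E)%E ->
  {ae P, forall x, g1 x <= g2 x}.
Proof.
move=> ig1 ig2; set B := [set x | _]; move=> int12.
have mg1 : measurable_fun setT g1.
  by apply/measurable_EFinP; exact: (measurable_int _ ig1).
have mg2 : measurable_fun setT g2.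
  by apply/measurable_EFinP; exact: (measurable_int _ ig2).
have mB : measurable B by rewrite -[B]setTI; exact: measurable_fun_ltr.
have iB1 : P.-integrable B (EFin \o g1) by exact: integrableS ig1.
have iB2 : P.-integrable B (EFin \o g2) by exact: integrableS ig2.
have : (\int[P]_(x in B) `|(g1 x - g2 x)%:E| = 0)%E.
  apply/eqP; rewrite eq_le; apply/andP; split; last exact: integral_ge0.
  have -> : (\int[P]_(x in B) `|(g1 x - g2 x)%:E|
      = \int[P]_(x in B) ((EFin \o g1) x - (EFin \o g2) x))%E.
    apply: eq_integral => x /[!inE] Bx /=.
    by rewrite ger0_norm// subr_ge0 ltW.
  rewrite integralB// sube_le0; first exact: int12.
move/ae_eq_integral_abs => /(_ mB); case.
  apply: measurable_funS measurableT _ _ => //.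
  by apply/measurable_EFinP; exact: measurable_funB.
move=> N [mN N0 BN]; exists N; split => // x /= /negP; rewrite -ltNge => gx.
apply: BN => /= /(_ gx) [] /eqP; rewrite subr_eq0 => /eqP gxE.
by move: gx; rewrite gxE ltxx.
Qed.

Lemma ae_le_integral dT (T : measurableType dT) (R : realType)
    (P : {measure set T -> \bar R}) (D : set T) (g1 g2 : T -> \bar R) :
  measurable D -> P.-integrable D g1 -> P.-integrable D g2 ->
  {ae P, forall x, (g1 x <= g2 x)%E} ->
  (\int[P]_(x in D) g1 x <= \int[P]_(x in D) g2 x)%E.
Proof.
move=> mD ig1 ig2 [N [mN N0 gN]].
rewrite (negligible_integral mN mD ig1)// (negligible_integral mN mD ig2)//.
apply: le_integral.
- exact: measurableD.
- by apply: integrableS ig1 => //; exact: measurableD.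
- by apply: integrableS ig2 => //; exact: measurableD.
- by move=> x; rewrite inE => -[_ Nx]; apply: contrapT => h; apply/Nx/gN.
Qed.

(** * Full domination as a family of inequalities on cylinders *)

Section domination.
Context (R : realType) (d : nat) (P : probability (config d) R).

Definition determined_by (s : seq 'rV[int]_d) (C : set (config d)) :=
  forall eta eta' : config d, {in s, eta =1 eta'} -> C eta -> C eta'.

(** Removing duplicates makes the enumeration injective, as the determinantal formula requires
    distinct sites. *)
Definition enum_sites (s : seq 'rV[int]_d) (i : 'I_(size (undup s))) : 'rV[int]_d :=
  nth 0 (undup s) i.

Lemma enum_sites_inj s : injective (@enum_sites s).
Proof.
by move=> i j /eqP; rewrite nth_uniq ?undup_uniq// => /eqP /val_inj.
Qed.

Lemma mem_enum_sites s i : @enum_sites s i \in s.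
Proof. by rewrite -mem_undup mem_nth. Qed.

Lemma determined_by_cylinders s C : determined_by s C ->
  C = \bigcup_(b in [set b : {ffun 'I_(size (undup s)) -> bool} |
        exists2 eta, C eta & cylinder (@enum_sites s) b eta])
      cylinder (@enum_sites s) b.
Proof.
move=> sC; apply/seteqP; split=> [eta Ceta|eta [b [eta' Ceta' eta'b] etab]].
  exists [ffun i => (eta : config d) (enum_sites i)].
    by exists eta => // i; rewrite ffunE.
  by move=> i; rewrite ffunE.
apply: sC Ceta' => k ks.
have ki : (index k (undup s) < size (undup s))%N by rewrite index_mem mem_undup.
have := etab (Ordinal ki); rewrite -(eta'b (Ordinal ki)) /enum_sites /=.
by rewrite nth_index ?mem_undup// => ->.
Qed.

Lemma measurable_cylinder n (e : 'I_n -> 'rV[int]_d) b :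
  measurable (cylinder e b).
Proof. apply: cylinder_sigma => i; exact: measurable_occupied. Qed.

Lemma le_measure_determined (m1 m2 : {measure set (config d) -> \bar R}) s C :
  (forall b, m1 (cylinder (@enum_sites s) b) <= m2 (cylinder (@enum_sites s) b))%E ->
  determined_by s C -> (m1 C <= m2 C)%E.
Proof.
move=> m12 sC; rewrite (determined_by_cylinders sC).
have tr D : trivIset D (fun b : {ffun 'I_(size (undup s)) -> bool} =>
    cylinder (@enum_sites s) b).
  move=> b b' _ _ [eta [etab etab']].
  by apply/ffunP => i; rewrite -etab -etab'.
have fin (D : set {ffun 'I_(size (undup s)) -> bool}) : finite_set D.
  exact: finite_finset.
have mcyl (D : set {ffun 'I_(size (undup s)) -> bool}) b :
    D b -> measurable (cylinder (@enum_sites s) b).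
  by move=> _; exact: measurable_cylinder.
rewrite (measure_fin_bigcup m1 (fin _) (tr _) (@mcyl _))//.
rewrite (measure_fin_bigcup m2 (fin _) (tr _) (@mcyl _))//.
by apply: lee_fsum => // b _; exact: m12.
Qed.

Lemma measurable_determined s C : determined_by s C -> measurable C.
Proof.
move=> /determined_by_cylinders ->; apply: fin_bigcup_measurable => //.
by move=> b _; exact: measurable_cylinder.
Qed.

Lemma off_origin_measurable : @off_origin d `<=` measurable.
Proof.
apply: smallest_sub; first exact: sigma_algebra_measurable.
by move=> _ [k _ ->]; exact: measurable_occupied.
Qed.

Lemma le_measure_off_origin (m1 m2 : {measure set (config d) -> \bar R}) :
  (forall A, measurable A -> (m1 A <= P A)%E) ->
  (forall A, measurable A -> (m2 A <= P A)%E) ->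
  (forall n (e : 'I_n -> 'rV[int]_d) b, injective e -> (forall i, e i != 0) ->
    (m1 (cylinder e b) <= m2 (cylinder e b))%E) ->
  forall B, @off_origin d B -> (m1 B <= m2 B)%E.
Proof.
move=> m1P m2P m12 B GB.
(* Cylinders are not closed under complement; the events determined by finitely many nonzero sites
   are, and they are finite disjoint unions of cylinders. *)
pose G : set (set (config d)) := [set C | exists2 s, 0 \notin s & determined_by s C].
apply: (@le_measure_generated _ _ _ P G) => //.
- move=> A A' [s s0 sA] [s' s'0 sA']; exists (s ++ s').
    by rewrite mem_cat negb_or s0.
  move=> eta eta' ee [Ae A'e]; split.
    by apply: sA Ae => k ks; apply: ee; rewrite mem_cat ks.
  by apply: sA' A'e => k ks; apply: ee; rewrite mem_cat ks orbT.
- move=> A [s s0 sA]; exists s => // eta eta' ee nA Ae; apply: nA.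
  by apply: sA Ae => k ks; rewrite ee.
- by exists [::].
- by move=> A [s _] /measurable_determined.
- move=> A [s s0 sA]; apply: le_measure_determined sA => b.
  apply: m12; first exact: enum_sites_inj.
  by move=> i; apply: contraNneq s0 => <-; exact: mem_enum_sites.
- move: B GB; apply: smallest_sub; first exact: smallest_sigma_algebra.
  move=> _ [k k0 ->]; apply: sub_sigma_algebra.
  exists [:: k]; first by rewrite inE eq_sym.
  by move=> eta eta' ee; rewrite /occupied /= -ee// inE.
Qed.

Lemma off_origin_cylinder n (e : 'I_n -> 'rV[int]_d) b :
  (forall i, e i != 0) -> @off_origin d (cylinder e b).
Proof.
by move=> e0; apply: cylinder_sigma => i; apply: sub_sigma_algebra; exists (e i).
Qed.

Let mocc : measurable (occupied (0 : 'rV[int]_d)) := measurable_occupied 0.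

Let restr_le A : measurable A -> (mrestr P mocc A <= P A)%E.
Proof. by move=> mA; exact: measureIl. Qed.

Let scale_le (r : {nonneg R}) A : r%:num <= 1 -> (mscale r P A <= P A)%E.
Proof.
move=> r1; rewrite /mscale/= -[leRHS]mul1e lee_wpmul2r//.
Qed.

(** Forward, integrate the bound over the cylinder. Backward, take any version [g] and test it on
    the event g < p, which lies in the sigma-field off the origin. *)
Lemma full_dom_by_productP (p : R) : 0 <= p <= 1 ->
  full_dom_by_product p P <->
  (forall n (e : 'I_n -> 'rV[int]_d) b, injective e -> (forall i, e i != 0) ->
    (p%:E * P (cylinder e b) <= P (occupied 0 `&` cylinder e b))%E).
Proof.
move=> /andP[p0 p1]; have icst := finite_measure_integrable_cst P p measurableT.
split=> [[g [_ gint gE] pg] n e b _ e0|H].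
  have mC := measurable_cylinder e b.
  rewrite -gE; last exact: off_origin_cylinder.
  rewrite -integral_cst//; apply: ae_le_integral => //.
  - by apply: integrableS icst.
  - by apply: integrableS gint.
have [|g gP] := @ex_cond_prob_version R _ _ P (occupied 0)
    [set A | exists2 k : 'rV[int]_d, k != 0 & A = occupied k] mocc.
  by move=> _ [k _ ->]; exact: measurable_occupied.
exists g => //; case: gP => mg gint gE.
apply: ae_le_of_integral => //.
have GB : @off_origin d [set x | g x < p].
  by have := mg `]-oo, p[%classic (measurable_itv _); rewrite set_itvNyo.
rewrite gE// integral_cst//; last exact: off_origin_measurable.
(* The measures compared are p P and P restricted to the event that the origin is occupied; p <= 1
   puts the first one below P. *)
rewrite setIC; apply: (@le_measure_off_origin (mscale (NngNum p0) P) (mrestr P mocc)) GB.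
- by move=> A _; exact: scale_le.
- exact: restr_le.
- by move=> n e b ei e0; have := H n e b ei e0; rewrite setIC.
Qed.

Lemma full_dom_productP (q : R) : 0 <= q <= 1 ->
  full_dom_product P q <->
  (forall n (e : 'I_n -> 'rV[int]_d) b, injective e -> (forall i, e i != 0) ->
    (P (occupied 0 `&` cylinder e b) <= q%:E * P (cylinder e b))%E).
Proof.
move=> /andP[q0 q1]; have icst := finite_measure_integrable_cst P q measurableT.
split=> [[g [_ gint gE] gq] n e b _ e0|H].
  have mC := measurable_cylinder e b.
  rewrite -gE; last exact: off_origin_cylinder.
  rewrite -integral_cst//; apply: ae_le_integral => //.
  - by apply: integrableS gint.
  - by apply: integrableS icst.
have [|g gP] := @ex_cond_prob_version R _ _ P (occupied 0)
    [set A | exists2 k : 'rV[int]_d, k != 0 & A = occupied k] mocc.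
  by move=> _ [k _ ->]; exact: measurable_occupied.
exists g => //; case: gP => mg gint gE.
apply: ae_le_of_integral => //.
have GB : @off_origin d [set x | q < g x].
  by have := mg `]q, +oo[%classic (measurable_itv _); rewrite set_itvoy.
rewrite gE// integral_cst//; last exact: off_origin_measurable.
rewrite setIC; apply: (@le_measure_off_origin (mrestr P mocc) (mscale (NngNum q0) P)) GB.
- exact: restr_le.
- by move=> A _; exact: scale_le.
- by move=> n e b ei e0; have := H n e b ei e0; rewrite setIC.
Qed.

End domination.

Section ordinal_cons.
Context (T : Type) (n : nat).

Definition ord_cons (x : T) (e : 'I_n -> T) (i : 'I_n.+1) : T :=
  oapp e x (unlift ord0 i).

Lemma ord_cons0 x e : ord_cons x e ord0 = x.
Proof. by rewrite /ord_cons unlift_none. Qed.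

Lemma ord_cons_lift x e i : ord_cons x e (lift ord0 i) = e i.
Proof. by rewrite /ord_cons liftK. Qed.

End ordinal_cons.

Lemma ord_cons_inj (T : eqType) n (x : T) (e : 'I_n -> T) :
  injective e -> (forall i, e i != x) -> injective (ord_cons x e).
Proof.
move=> ei ex i j; case: (unliftP ord0 i) => [i' ->|->];
  case: (unliftP ord0 j) => [j' ->|->]; rewrite ?ord_cons0 ?ord_cons_lift //.
- by move/ei ->.
- by move/eqP; rewrite (negbTE (ex _)).
- by move/esym/eqP; rewrite (negbTE (ex _)).
Qed.

(** * Cylinder probabilities as determinants *)

Section determinantal_cylinder.
Context (R : realType) (d : nat).
Local Notation C := (complex R).

Lemma cylinder_ord_cons n (e : 'I_n -> 'rV[int]_d) b k (c : bool) :
  cylinder (ord_cons k e) (ord_cons c b) =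
  [set eta : config d | eta k = c] `&` cylinder e b.
Proof.
apply/seteqP; split=> [eta h|eta [h0 h] i].
  split=> [|i]; first by have := h ord0; rewrite !ord_cons0.
  by have := h (lift ord0 i); rewrite !ord_cons_lift.
by case: (unliftP ord0 i) => [i' ->|->]; rewrite ?ord_cons0 ?ord_cons_lift.
Qed.

Definition kernel_mx (f : d.-tuple R -> R) n (e : 'I_n -> 'rV[int]_d) : 'M[C]_n :=
  \matrix_(i < n, j < n) fourier_coef f (e j - e i).

(* Inclusion-exclusion: switching the requirement at a site from 1 to 0 turns
   the row K_i into delta_i - K_i. *)
Lemma prob_cylinder (f : d.-tuple R -> R) (P : probability (config d) R) n
    (e : 'I_n -> 'rV[int]_d) b :
  is_determinantal f P -> injective e ->
  (fine (P (cylinder e b)))%:C%C = \det (cyl_mx b (kernel_mx f e)).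
Proof.
move=> dP.
(* Induction on the number of sites prescribed to be 0. *)
have [m mb] : exists m, (\sum_(i < n) ~~ b i = m)%N by eexists.
elim: m n e b mb => [|m IH] n e b mb ei.
  have bT i : b i.
    by move/eqP: mb; rewrite sum_nat_eq0 => /forallP /(_ i); case: (b i).
  have -> : cyl_mx b (kernel_mx f e) = kernel_mx f e.
    by apply/matrixP => i j; rewrite mxE bT.
  (* The determinantal formula assumes at least one site; without sites the cylinder is the whole
     space and the empty determinant is 1. *)
  case: n e b mb ei bT => [|n] e b mb ei bT.
    rewrite det_mx00; have -> : cylinder e b = setT.
      by apply/seteqP; split => // eta _ [].
    by rewrite probability_setT.
  rewrite -dP//; congr (fine (P _))%:C%C.
  by apply/seteqP; split => eta h i; rewrite h ?bT.
have [i0 bi0] : exists i0, ~~ b i0.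
  apply: contrapT => /forallNP h; move: mb; rewrite big1// => i _.
  by have := h i; case: (b i) => // /(_ isT).
case: n e b mb ei i0 bi0 => [|n] e b mb ei i0 bi0; first by case: i0 bi0.
pose b1 i := (i == i0) || b i.
have mb1 : (\sum_(i < n.+1) ~~ b1 i = m)%N.
  move: mb; rewrite (bigD1 i0)//= bi0 add1n => -[<-].
  rewrite (bigD1 i0)//= /b1 eqxx add0n; apply: eq_bigr => i ii0.
  by rewrite (negbTE ii0).
have mb' : (\sum_(i < n) ~~ b (lift i0 i) = m)%N.
  by move: mb; rewrite (bigD1_ord i0)//= bi0 add1n => -[<-].
have ei' : injective (e \o lift i0) by apply: inj_comp ei lift_inj.
have mc k (e' : 'I_k -> 'rV[int]_d) b' := measurable_cylinder e' b'.
(* The cylinder that ignores [i0] splits according to the value there. It and the cylinder of [b1]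
   both prescribe one 0 fewer, so the induction hypothesis covers each. *)
have -> : P (cylinder e b) =
    (P (cylinder (e \o lift i0) (b \o lift i0)) - P (cylinder e b1))%E.
  have -> : cylinder (e \o lift i0) (b \o lift i0) = cylinder e b `|` cylinder e b1.
    apply/seteqP; split=> [eta h|eta [|] h i].
    - case E : (eta (e i0)); [right|left] => i; rewrite /b1.
        have [->|i'] := eqVneq i i0; first by rewrite E.
        by case: (unliftP i0 i) i' => [j -> _|->]; rewrite ?eqxx//; exact: h.
      case: (unliftP i0 i) => [j ->|->]; first exact: h.
      by rewrite E (negbTE bi0).
    - exact: h.
    - by rewrite h /b1 eq_sym (negbTE (neq_lift _ _)).
  rewrite measureU//.
    by rewrite addeK// fin_num_measure.
  rewrite -subset0 => eta [h h1]; have := h i0; rewrite (h1 i0) /b1 eqxx /=.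
  by move=> bT; move: bi0; rewrite -bT.
rewrite fineB ?fin_num_measure// rmorphB /= !IH//.
rewrite (@det_add_delta _ _ i0 (cyl_mx b1 (kernel_mx f e)) (cyl_mx b (kernel_mx f e)) (-1) 1).
- rewrite mulN1r mul1r [RHS]addrC; congr (\det _ - _).
  apply/matrixP => i j; rewrite !mxE /= /b1 [lift _ _ == i0]eq_sym (negbTE (neq_lift _ _)) /=.
  by rewrite (inj_eq lift_inj).
- by move=> i j ii0; rewrite !mxE /b1 (negbTE ii0).
- by move=> j; rewrite !mxE /b1 eqxx (negbTE bi0) /=; ring.
Qed.

End determinantal_cylinder.

(** * Integration on the torus *)

Section bounded_measurable.
Context dT (T : measurableType dT) (R : realType).
Local Notation C := (complex R).

Definition bounded_mfun (F : T -> R) :=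
  measurable_fun setT F /\ exists M, forall x, `|F x| <= M.

Lemma bounded_mfun_cst c : bounded_mfun (fun=> c).
Proof. by split => //; exists `|c|. Qed.

Lemma bounded_mfunD F G : bounded_mfun F -> bounded_mfun G ->
  bounded_mfun (fun x => F x + G x).
Proof.
move=> [mF [M FM]] [mG [N GN]]; split; first exact: measurable_funD.
by exists (M + N) => x; rewrite (le_trans (ler_normD _ _))// lerD.
Qed.

Lemma bounded_mfunM F G : bounded_mfun F -> bounded_mfun G ->
  bounded_mfun (fun x => F x * G x).
Proof.
move=> [mF [M FM]] [mG [N GN]]; split; first exact: measurable_funM.
by exists (M * N) => x; rewrite normrM ler_pM.
Qed.

Lemma bounded_mfunN F : bounded_mfun F -> bounded_mfun (fun x => - F x).
Proof.
move=> [mF [M FM]]; split; first exact: measurableT_comp.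
by exists M => x; rewrite normrN.
Qed.

Lemma bounded_mfunB F G : bounded_mfun F -> bounded_mfun G ->
  bounded_mfun (fun x => F x - G x).
Proof. by move=> bF bG; exact: bounded_mfunD bF (bounded_mfunN bG). Qed.

Lemma bounded_mfun_integrable (P : probability T R) F :
  bounded_mfun F -> P.-integrable setT (EFin \o F).
Proof.
move=> [mF [M FM]]; apply: measurable_bounded_integrable => //.
  by rewrite ltey_eq fin_num_measure.
by exists M; split; rewrite ?num_real// => N MN x _ /=; apply: le_trans (FM x) _; exact: ltW.
Qed.

Definition bounded_cmfun (F : T -> C) :=
  bounded_mfun (fun x => complex.Re (F x)) /\ bounded_mfun (fun x => complex.Im (F x)).

Lemma bounded_cmfunD F G : bounded_cmfun F -> bounded_cmfun G ->
  bounded_cmfun (fun x => F x + G x).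
Proof.
move=> [rF iF] [rG iG]; split.
  rewrite [X in bounded_mfun X](_ : _ = fun x => complex.Re (F x) + complex.Re (G x)).
    exact: bounded_mfunD.
  by apply/funext => x; case: (F x) (G x) => ? ? [].
rewrite [X in bounded_mfun X](_ : _ = fun x => complex.Im (F x) + complex.Im (G x)).
  exact: bounded_mfunD.
by apply/funext => x; case: (F x) (G x) => ? ? [].
Qed.

Lemma bounded_cmfunM F G : bounded_cmfun F -> bounded_cmfun G ->
  bounded_cmfun (fun x => F x * G x).
Proof.
move=> [rF iF] [rG iG]; split.
  rewrite [X in bounded_mfun X](_ : _ = fun x =>
    complex.Re (F x) * complex.Re (G x) - complex.Im (F x) * complex.Im (G x)).
    by apply: bounded_mfunB; exact: bounded_mfunM.
  by apply/funext => x; case: (F x) (G x) => ? ? [].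
rewrite [X in bounded_mfun X](_ : _ = fun x =>
    complex.Re (F x) * complex.Im (G x) + complex.Im (F x) * complex.Re (G x)).
  by apply: bounded_mfunD; exact: bounded_mfunM.
by apply/funext => x; case: (F x) (G x) => ? ? [].
Qed.

Lemma bounded_cmfun_real F : bounded_mfun F -> bounded_cmfun (fun x => (F x)%:C%C).
Proof. by move=> bF; split => //; exact: bounded_mfun_cst. Qed.

Lemma bounded_cmfun_cst c : bounded_cmfun (fun=> c).
Proof. by split; exact: bounded_mfun_cst. Qed.

Lemma bounded_cmfun_sum I (r : seq I) (F : I -> T -> C) :
  (forall i, bounded_cmfun (F i)) -> bounded_cmfun (fun x => \sum_(i <- r) F i x).
Proof.
move=> bF; elim: r => [|i r IH].
  rewrite [X in bounded_cmfun X](_ : _ = fun=> 0); first exact: bounded_cmfun_cst.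
  by apply/funext => x; rewrite big_nil.
rewrite [X in bounded_cmfun X](_ : _ = fun x => F i x + \sum_(i <- r) F i x).
  exact: bounded_cmfunD.
by apply/funext => x; rewrite big_cons.
Qed.

Context (P : probability T R).

Definition cint (F : T -> C) : C :=
  Complex (\int[P]_x complex.Re (F x)) (\int[P]_x complex.Im (F x)).

Let bint := bounded_mfun_integrable P.

Lemma cintD F G : bounded_cmfun F -> bounded_cmfun G ->
  cint (fun x => F x + G x) = cint F + cint G.
Proof.
move=> [rF iF] [rG iG]; rewrite /cint.
rewrite -[RHS]/(Complex (_ + _) (_ + _)) -!RintegralD//; try exact: bint.
by congr Complex; apply: eq_Rintegral => x _; case: (F x) (G x) => ? ? [].
Qed.

Lemma cintZ c F : bounded_cmfun F -> cint (fun x => c * F x) = c * cint F.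
Proof.
move=> [rF iF]; rewrite /cint; case: c => a b.
rewrite -[RHS]/(Complex (_ - _) (_ + _)) -!RintegralZl//; try exact: bint.
have bZ (r : R) G : bounded_mfun G -> P.-integrable setT (EFin \o (fun x => r * G x)).
  by move=> bG; apply: bint; apply: bounded_mfunM => //; exact: bounded_mfun_cst.
rewrite -RintegralB// -?RintegralD//; try exact: bZ.
by congr Complex; apply: eq_Rintegral => x _; case: (F x).
Qed.

Lemma cint_sum I (r : seq I) (F : I -> T -> C) : (forall i, bounded_cmfun (F i)) ->
  cint (fun x => \sum_(i <- r) F i x) = \sum_(i <- r) cint (F i).
Proof.
move=> bF; elim: r => [|i r IH].
  (* Writing 0 as a product lets homogeneity compute the integral of the empty sum. *)
  rewrite big_nil (_ : (fun x => _) = fun x => 0 * 0); last first.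
    by apply/funext => x; rewrite big_nil mul0r.
  by rewrite cintZ ?mul0r//; exact: bounded_cmfun_cst.
rewrite big_cons -IH -cintD//; last exact: bounded_cmfun_sum.
by congr cint; apply/funext => x; rewrite big_cons.
Qed.

Lemma Rintegral_prob_cst (c : R) : \int[P]_x c = c.
Proof.
transitivity (c * fine (P setT)); first exact: Rintegral_cst.
by rewrite probability_setT mulr1.
Qed.

Lemma cint_real (F : T -> R) :
  cint (fun x => (F x)%:C%C) = (\int[P]_x F x)%:C%C.
Proof. by rewrite /cint/= Rintegral_prob_cst. Qed.

Lemma cint_conj F : bounded_cmfun F -> cint (fun x => (F x)^*) = (cint F)^*.
Proof.
move=> [rF iF]; rewrite /cint -[RHS]/(Complex _ (- _)); congr Complex.
  by apply: eq_Rintegral => x _; case: (F x).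
rewrite -[RHS]mulN1r -RintegralZl//; last exact: bint.
by apply: eq_Rintegral => x _; case: (F x) => a b /=; rewrite mulN1r.
Qed.

End bounded_measurable.

Section product_integral.
Context d1 d2 (T1 : measurableType d1) (T2 : measurableType d2) (R : realType).
Context (P1 : probability T1 R) (P2 : probability T2 R).
Local Notation C := (complex R).

Lemma bounded_mfun_fst (a : T1 -> R) :
  bounded_mfun a -> bounded_mfun (fun z : T1 * T2 => a z.1).
Proof.
move=> [ma [M aM]]; split; last by exists M.
exact: measurableT_comp ma measurable_fst.
Qed.

Lemma bounded_mfun_snd (b : T2 -> R) :
  bounded_mfun b -> bounded_mfun (fun z : T1 * T2 => b z.2).
Proof.
move=> [mb [M bM]]; split; last by exists M.
exact: measurableT_comp mb measurable_snd.
Qed.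

Lemma Rintegral_prod (a : T1 -> R) (b : T2 -> R) :
  bounded_mfun a -> bounded_mfun b ->
  \int[(P1 \x P2)%E]_z (a z.1 * b z.2) = (\int[P1]_x a x) * (\int[P2]_x b x).
Proof.
move=> ba bb.
have iab : ((P1 \x P2)%E).-integrable setT (fun z => (a z.1 * b z.2)%:E).
  have bab : bounded_mfun (fun z => a z.1 * b z.2).
    by apply: bounded_mfunM; [exact: bounded_mfun_fst|exact: bounded_mfun_snd].
  exact: (bounded_mfun_integrable (P1 \x P2)%E bab).
rewrite /Rintegral -integral12_prod_meas1//.
have inner x : fubini_F P2 (fun z => (a z.1 * b z.2)%:E) x =
    ((\int[P2]_y b y)%:E * (a x)%:E)%E.
  rewrite /fubini_F /=; under eq_integral do rewrite EFinM.
  rewrite integralZl//; last exact: bounded_mfun_integrable bb.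
  rewrite muleC; congr (_ * _)%E; rewrite /Rintegral fineK//.
  by apply: integrable_fin_num => //; exact: bounded_mfun_integrable bb.
rewrite [in LHS](eq_integral (fun x => ((\int[P2]_y b y)%:E * (a x)%:E)%E)); last first.
  by move=> x _; exact: inner.
rewrite integralZl//; last exact: bounded_mfun_integrable ba.
rewrite fineM//; first by rewrite mulrC.
by apply: integrable_fin_num => //; exact: bounded_mfun_integrable ba.
Qed.

Lemma cint_prod (a : T1 -> C) (b : T2 -> C) :
  bounded_cmfun a -> bounded_cmfun b ->
  cint (P1 \x P2)%E (fun z => a z.1 * b z.2) = cint P1 a * cint P2 b.
Proof.
move=> [ra ia] [rb ib]; rewrite /cint -[RHS]/(Complex (_ - _) (_ + _)).
have bp (u : T1 -> R) (v : T2 -> R) : bounded_mfun u -> bounded_mfun v ->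
    ((P1 \x P2)%E).-integrable setT (EFin \o (fun z => u z.1 * v z.2)).
  move=> bu bv; apply: (@bounded_mfun_integrable _ _ _ (P1 \x P2)%E (fun z => u z.1 * v z.2)).
  by apply: bounded_mfunM; [exact: bounded_mfun_fst|exact: bounded_mfun_snd].
rewrite -!Rintegral_prod//; congr Complex.
- rewrite -(RintegralB measurableT (bp _ _ ra rb) (bp _ _ ia ib)).
  by apply: eq_Rintegral => z _; case: (a z.1) (b z.2) => ? ? [].
- rewrite -(RintegralD measurableT (bp _ _ ra ib) (bp _ _ ia rb)).
  by apply: eq_Rintegral => z _; case: (a z.1) (b z.2) => ? ? [].
Qed.

End product_integral.

(** * Integrals of sine and cosine over the unit interval *)

Section unit_interval.
Context (R : realType).
Local Notation U := (uniform_prob (@ltr01 R)).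

Lemma uniform_FTC (g G : R -> R) :
  (forall x, 0 <= g x) -> continuous g -> (forall x : R, is_derive x (1 : R) G (g x)) ->
  (\int[U]_x (g x)%:E = (G 1 - G 0)%:E)%E.
Proof.
move=> g0 cg dG.
rewrite integral_uniform//; last first.
  by apply/measurable_EFinP; exact: continuous_measurable_fun.
rewrite subr0 invr1 mul1e EFinB.
have cG : continuous G.
  by move=> x; apply: differentiable_continuous; apply/derivable1_diffP; have [] := dG x.
apply: continuous_FTC2 => //.
- exact: continuous_subspaceT.
- split.
  + by move=> x _; have [] := dG x.
  + by apply: cvg_at_right_filter; exact: cG.
  + by apply: cvg_at_left_filter; exact: cG.
- by move=> x _; rewrite derive1E; have [_] := dG x.
Qed.

Lemma uniform_FTC1 (g G : R -> R) :
  (forall x, `|g x| <= 1) -> continuous g -> (forall x : R, is_derive x (1 : R) G (g x)) ->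
  \int[U]_x g x = G 1 - G 0.
Proof.
move=> g1 cg dG.
have bg : @bounded_mfun _ (measurableTypeR R) R g.
  by split; [exact: continuous_measurable_fun|exists 1].
(* Adding 1 to a function bounded by 1 gives the nonnegative integrand that [uniform_FTC] asks
   for. *)
have : (\int[U]_x (1 + g x)%:E = ((1 + G 1) - (0 + G 0))%:E)%E.
  apply: (@uniform_FTC (fun x => 1 + g x) (fun x => x + G x)).
  - by move=> x; have := g1 x; rewrite ler_norml -subr_ge0 opprK addrC => /andP[].
  - by move=> x; apply: cvgD; [exact: cvg_cst|exact: cg].
move/(congr1 fine); rewrite -/(Rintegral _ _ _) RintegralD//.
- rewrite Rintegral_cst// => h; apply: (@addrI _ 1).
  have -> : 1 + \int[U]_x g x = 1 * fine (U setT) + \int[U]_x g x.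
    by rewrite probability_setT mul1r.
  rewrite h /=; ring.
- exact: (bounded_mfun_integrable U (bounded_mfun_cst _ 1)).
- exact: bounded_mfun_integrable.
Qed.

Lemma cos_2piz (k : int) : cos (2 * pi * k%:~R) = 1 :> R.
Proof.
have cosn n : cos (2 * pi * n%:R) = 1 :> R.
  have := periodicn (@cosD2pi R) n 0; rewrite add0r cos0 => h; rewrite -[RHS]h.
  by congr cos; rewrite -mulrnA -[RHS]mulr_natr natrM; ring.
case: k => n; first exact: cosn.
by rewrite NegzE mulrNz mulrN cosN; exact: cosn.
Qed.

Lemma sin_2piz (k : int) : sin (2 * pi * k%:~R) = 0 :> R.
Proof.
have sinn n : sin (2 * pi * n%:R) = 0 :> R.
  have := periodicn (@sinD2pi R) n 0; rewrite add0r sin0 => h; rewrite -[RHS]h.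
  by congr sin; rewrite -mulrnA -[RHS]mulr_natr natrM; ring.
case: k => n; first exact: sinn.
by rewrite NegzE mulrNz mulrN sinN -[RHS]oppr0; congr (- _); exact: sinn.
Qed.

Lemma integral_cos_2piz (k : int) : k != 0 ->
  \int[U]_x cos (2 * pi * (k%:~R * x)) = 0.
Proof.
move=> k0; have c0 : 2 * pi * k%:~R != 0 :> R.
  by rewrite !mulf_neq0 ?pnatr_eq0 ?intr_eq0// gt_eqF// pi_gt0.
set c := 2 * pi * k%:~R in c0.
have dc (x : R) : is_derive x (1 : R) (fun y : R => c * y) c.
  by apply: is_derive_eq; rewrite /GRing.scale /= mulr1.
have dG (x : R) : is_derive x (1 : R) (fun y : R => c^-1 * sin (c * y))
    (cos (2 * pi * (k%:~R * x))).
  have ds := @is_derive1_comp _ sin _ x _ _ (is_derive_sin _) (dc x).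
  apply: (@is_derive_eq _ _ _ _ _ _ _ _ (is_deriveZ c^-1 ds)).
  by rewrite /GRing.scale /= mulrA mulrAC mulVf// mul1r mulrA.
rewrite (uniform_FTC1 _ _ dG).
- by rewrite mulr1 mulr0 sin0 sin_2piz mulr0 subrr.
- by move=> x; rewrite ler_norml cos_geN1 cos_le1.
- move=> x; apply: continuous_comp; last exact: continuous_cos.
  by apply: cvgM; [exact: cvg_cst|apply: cvgM; [exact: cvg_cst|exact: cvg_id]].
Qed.

Lemma integral_sin_2piz (k : int) :
  \int[U]_x sin (2 * pi * (k%:~R * x)) = 0.
Proof.
have [->|k0] := eqVneq k 0.
  under eq_Rintegral do rewrite mul0r mulr0 sin0.
  exact: Rintegral_prob_cst.
have c0 : 2 * pi * k%:~R != 0 :> R.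
  by rewrite !mulf_neq0 ?pnatr_eq0 ?intr_eq0// gt_eqF// pi_gt0.
set c := 2 * pi * k%:~R in c0.
have dc (x : R) : is_derive x (1 : R) (fun y : R => c * y) c.
  by apply: is_derive_eq; rewrite /GRing.scale /= mulr1.
have dG (x : R) : is_derive x (1 : R) (fun y : R => (- c)^-1 * cos (c * y))
    (sin (2 * pi * (k%:~R * x))).
  have ds := @is_derive1_comp _ cos _ x _ _ (is_derive_cos _) (dc x).
  apply: (@is_derive_eq _ _ _ _ _ _ _ _ (is_deriveZ (- c)^-1 ds)).
  by rewrite /GRing.scale /= mulNr -mulrN mulrA mulrAC mulVf ?oppr_eq0// mul1r mulrA.
rewrite (uniform_FTC1 _ _ dG).
- by rewrite mulr1 mulr0 cos0 cos_2piz subrr.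
- by move=> x; rewrite ler_norml sin_geN1 sin_le1.
- move=> x; apply: continuous_comp; last exact: continuous_sin.
  by apply: cvgM; [exact: cvg_cst|apply: cvgM; [exact: cvg_cst|exact: cvg_id]].
Qed.

End unit_interval.

(** * Characters of the torus and their orthogonality *)

Section torus_characters.
Context (R : realType).
Local Notation C := (complex R).

(** This is exp(-it), with the sign of the Fourier coefficients. *)
Definition expi (t : R) : C := Complex (cos t) (- sin t).

Lemma expiD s t : expi (s + t) = expi s * expi t.
Proof.
rewrite /expi -[RHS]/(Complex (_ - _) (_ + _)) cosD sinD; congr Complex; ring.
Qed.

Lemma expi0 : expi 0 = 1.
Proof. by rewrite /expi cos0 sin0 oppr0. Qed.

Lemma expiN t : expi (- t) = (expi t)^*.
Proof. by rewrite /expi cosN sinN. Qed.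

Definition character d (k : 'rV[int]_d) (x : d.-tuple R) : C :=
  expi (2 * pi * dotZ k x).

Lemma characterD d (k l : 'rV[int]_d) x :
  character (k + l) x = character k x * character l x.
Proof.
rewrite /character -expiD -mulrDr; congr (expi (_ * _)).
by rewrite /dotZ -big_split; apply: eq_bigr => i _; rewrite mxE intrD mulrDl.
Qed.

Lemma characterN d (k : 'rV[int]_d) x : character (- k) x = (character k x)^*.
Proof.
rewrite /character -expiN -mulrN; congr (expi (_ * _)).
by rewrite /dotZ -sumrN; apply: eq_bigr => i _; rewrite mxE mulrNz mulNr.
Qed.

Lemma character0 d x : character (0 : 'rV[int]_d) x = 1.
Proof.
rewrite /character /dotZ big1 ?mulr0 ?expi0// => i _.
by rewrite mxE mul0r.
Qed.

Lemma measurable_dotZ d (k : 'rV[int]_d) : measurable_fun setT (@dotZ R d k).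
Proof.
apply: measurable_sum => i; apply: measurable_funM => //.
exact: measurable_tnth.
Qed.

Lemma bounded_character d (k : 'rV[int]_d) : bounded_cmfun (character k).
Proof.
have m : measurable_fun setT (fun x : d.-tuple R => 2 * pi * dotZ k x).
  by apply: measurable_funM => //; exact: measurable_dotZ.
split; split.
- apply: (measurableT_comp _ m); apply: continuous_measurable_fun; exact: continuous_cos.
- by exists 1 => x /=; rewrite ler_norml cos_geN1 cos_le1.
- apply: (@measurable_funN _ _ _ _ (fun x : d.-tuple R => sin (2 * pi * dotZ k x))).
  apply: (measurableT_comp _ m); apply: continuous_measurable_fun; exact: continuous_sin.
- by exists 1 => x /=; rewrite normrN ler_norml sin_geN1 sin_le1.
Qed.

Lemma cint_torus_cons d (F : d.+1.-tuple R -> C) : bounded_cmfun F ->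
  cint (torus_measure R d.+1) F =
  cint (uniform_prob (@ltr01 R) \x torus_measure R d)%E (F \o @tuple_cons R d).
Proof.
move=> [[mr [M rM]] [mi [N iN]]]; rewrite /cint /Rintegral; congr (Complex (fine _) (fine _)).
  rewrite integral_distribution//.
    exact/measurable_EFinP.
  apply: (@bounded_mfun_integrable _ _ _ (uniform_prob (@ltr01 R) \x torus_measure R d)%E
    (fun z => complex.Re (F (tuple_cons z)))).
  split; last by exists M.
  exact: measurableT_comp mr (@measurable_tuple_cons R d).
rewrite integral_distribution//.
  exact/measurable_EFinP.
apply: (@bounded_mfun_integrable _ _ _ (uniform_prob (@ltr01 R) \x torus_measure R d)%E
  (fun z => complex.Im (F (tuple_cons z)))).
split; last by exists N.
exact: measurableT_comp mi (@measurable_tuple_cons R d).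
Qed.

(** A character is an exponential in the first coordinate times a character in the others, so the
    integral factorises by Fubini. *)
Lemma cint_character d (k : 'rV[int]_d) :
  cint (torus_measure R d) (character k) = (k == 0)%:R.
Proof.
elim: d k => [|d IH] k.
  have -> : k = 0 by apply/rowP => -[].
  rewrite eqxx (_ : character 0 = fun x => (1:R)%:C%C); last first.
    by apply/funext => x; rewrite character0.
  by rewrite cint_real Rintegral_prob_cst.
rewrite cint_torus_cons; last exact: bounded_character.
pose k' : 'rV[int]_d := \row_i k ord0 (lift ord0 i).
pose k0 := k ord0 ord0.
pose a (x : measurableTypeR R) := expi (2 * pi * (k0%:~R * x)).
rewrite (_ : character k \o _ = fun z => a z.1 * character k' z.2); last first.
  apply/funext => -[x y]; rewrite /= /character /a -expiD -mulrDr.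
  congr (expi (_ * _)); rewrite /dotZ big_ord_recl; congr (_ * _ + _) => //.
  by apply: eq_bigr => i _; rewrite mxE tnthS.
have m : measurable_fun setT (fun x : measurableTypeR R => 2 * pi * (k0%:~R * x)).
  by apply: measurable_funM => //; exact: measurable_funM.
have ba : bounded_cmfun a.
  split; split.
  - apply: (measurableT_comp _ m); apply: continuous_measurable_fun; exact: continuous_cos.
  - by exists 1 => x /=; rewrite ler_norml cos_geN1 cos_le1.
  - apply: (@measurable_funN _ _ _ _ (fun x : measurableTypeR R => sin (2 * pi * (k0%:~R * x)))).
    apply: (measurableT_comp _ m); apply: continuous_measurable_fun; exact: continuous_sin.
  - by exists 1 => x /=; rewrite normrN ler_norml sin_geN1 sin_le1.
rewrite cint_prod//; last exact: bounded_character.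
rewrite IH.
have -> : cint (uniform_prob (@ltr01 R)) a = (k0 == 0)%:R.
  have [k00|k0n0] := eqVneq k0 0.
    rewrite (_ : a = fun x => (1:R)%:C%C) ?cint_real ?Rintegral_prob_cst//.
    by apply/funext => x; rewrite /a k00 mul0r mulr0 expi0.
  rewrite /cint /a /= integral_cos_2piz//.
  under eq_Rintegral do rewrite -mulN1r.
  rewrite RintegralZl//; first by rewrite integral_sin_2piz mulr0.
  apply: (@bounded_mfun_integrable _ _ _ (uniform_prob (@ltr01 R))
    (fun x => sin (2 * pi * (k0%:~R * x)))).
  split; last by exists 1 => x /=; rewrite ler_norml sin_geN1 sin_le1.
  apply: (measurableT_comp _ m); apply: continuous_measurable_fun; exact: continuous_sin.
rewrite -natrM mulnb; congr (nat_of_bool _)%:R.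
apply/andP/eqP => [[/eqP k00 /eqP k'0]|kz].
  apply/rowP => i; rewrite mxE; case: (unliftP ord0 i) => [j ->|-> //].
  by have := congr1 (fun r : 'rV_d => r ord0 j) k'0; rewrite !mxE.
by rewrite /k0 kz mxE eqxx; split => //; apply/eqP/rowP => i; rewrite !mxE kz mxE.
Qed.

End torus_characters.

(** * The quadratic form of the Fourier kernel *)

Section kernel_form.
Context (R : realType) (d : nat).
Local Notation C := (complex R).
Local Notation T := (d.-tuple R).
Local Notation mu := (torus_measure R d).

Definition normsq (z : C) : R := complex.Re z ^+ 2 + complex.Im z ^+ 2.

Lemma normsqE (z : C) : (normsq z)%:C%C = z^* * z.
Proof. by rewrite mulrC -normCK /normsq add_Re2_Im2. Qed.

Lemma normsq_ge0 z : 0 <= normsq z.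
Proof. by rewrite addr_ge0// sqr_ge0. Qed.

Lemma bounded_normsq dS (S : measurableType dS) (F : S -> C) :
  bounded_cmfun F -> bounded_mfun (fun x => normsq (F x)).
Proof. by move=> [rF iF]; apply: bounded_mfunD; apply: bounded_mfunM. Qed.

Lemma fourier_coefE (f : T -> R) k : bounded_mfun f ->
  fourier_coef f k = cint mu (fun x => (f x)%:C%C * character k x).
Proof.
move=> bf; rewrite /cint /fourier_coef; congr Complex.
  by apply: eq_Rintegral => x _ /=; rewrite mul0r subr0.
rewrite -mulN1r -RintegralZl//.
  by apply: eq_Rintegral => x _ /=; rewrite mul0r addr0 mulN1r mulrN.
have [_ bs] := @bounded_character R d k.
have bs' : bounded_mfun (fun x : T => sin (2 * pi * dotZ k x)).
  rewrite [X in bounded_mfun X](_ : _ = fun x => - complex.Im (character k x)).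
    exact: bounded_mfunN.
  by apply/funext => x /=; rewrite opprK.
exact: (bounded_mfun_integrable mu (bounded_mfunM bf bs')).
Qed.

Let bounded_fchar (f : T -> R) (k : 'rV[int]_d) : bounded_mfun f ->
  bounded_cmfun (fun x => (f x)%:C%C * character k x).
Proof.
move=> bf; apply: bounded_cmfunM; first exact: bounded_cmfun_real.
exact: bounded_character.
Qed.

Lemma kernel_mx_hermitian (f : T -> R) n (e : 'I_n -> 'rV[int]_d) :
  bounded_mfun f -> self_adjoint (kernel_mx f e).
Proof.
move=> bf i j; rewrite !mxE !fourier_coefE// -cint_conj; last exact: bounded_fchar.
congr cint; apply/funext => x; rewrite -opprB characterN.
by rewrite rmorphM /= conj_real.
Qed.

Definition trig_sum n (e : 'I_n -> 'rV[int]_d) (v : 'I_n -> C) (x : T) : C :=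
  \sum_j v j * character (e j) x.

Lemma bounded_trig_sum n (e : 'I_n -> 'rV[int]_d) v : bounded_cmfun (trig_sum e v).
Proof.
apply: bounded_cmfun_sum => j; apply: bounded_cmfunM; first exact: bounded_cmfun_cst.
exact: bounded_character.
Qed.

Lemma qform_kernel_mx (f : T -> R) n (e : 'I_n -> 'rV[int]_d) v : bounded_mfun f ->
  qform (kernel_mx f e) v = (\int[mu]_x (f x * normsq (trig_sum e v x)))%:C%C.
Proof.
move=> bf; rewrite -cint_real.
pose t i j x : C := ((v i)^* * v j) * ((f x)%:C%C * character (e j - e i) x).
have bt i j : bounded_cmfun (t i j).
  by apply: bounded_cmfunM; [exact: bounded_cmfun_cst|exact: bounded_fchar].
transitivity (cint mu (fun x => \sum_i \sum_j t i j x)).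
  rewrite cint_sum; last by move=> i; exact: bounded_cmfun_sum.
  apply: eq_bigr => i _; rewrite cint_sum//; apply: eq_bigr => j _.
  by rewrite cintZ ?mxE ?fourier_coefE//; [ring|exact: bounded_fchar].
congr cint; apply/funext => x.
rewrite rmorphM /= normsqE /trig_sum rmorph_sum /= mulr_suml mulr_sumr.
apply: eq_bigr => i _; rewrite mulr_sumr mulr_sumr; apply: eq_bigr => j _.
by rewrite /t characterD characterN rmorphM /=; ring.
Qed.

Lemma fourier_coef1 (k : 'rV[int]_d) : fourier_coef (fun=> 1 : R) k = (k == 0)%:R.
Proof.
rewrite fourier_coefE; last exact: bounded_mfun_cst.
rewrite -cint_character; congr cint; apply/funext => x.
by rewrite rmorph1 mul1r.
Qed.

Lemma fourier_coef1B (f : T -> R) (k : 'rV[int]_d) : bounded_mfun f ->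
  fourier_coef (fun x => 1 - f x) k = (k == 0)%:R - fourier_coef f k.
Proof.
move=> bf; have b1 := bounded_mfun_cst T (1 : R).
rewrite -fourier_coef1 !fourier_coefE//; last exact: bounded_mfunB.
rewrite -[X in _ - X]mul1r -mulNr -cintZ -?cintD; try exact: bounded_fchar.
- by congr cint; apply/funext => x; rewrite rmorphB /=; ring.
- by apply: bounded_cmfunM; [exact: bounded_cmfun_cst|exact: bounded_fchar].
Qed.

Lemma kernel_mx1B (f : T -> R) n (e : 'I_n -> 'rV[int]_d) : bounded_mfun f -> injective e ->
  forall i j, kernel_mx (fun x => 1 - f x) e i j = (i == j)%:R - kernel_mx f e i j.
Proof.
move=> bf ei i j; rewrite !mxE fourier_coef1B// subr_eq0 (inj_eq ei).
by rewrite eq_sym.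
Qed.

Lemma cint_trig_sum n (e : 'I_n -> 'rV[int]_d) v :
  cint mu (trig_sum e v) = \sum_(j | e j == 0) v j.
Proof.
rewrite cint_sum; last first.
  move=> j; apply: bounded_cmfunM; first exact: bounded_cmfun_cst.
  exact: bounded_character.
rewrite [RHS]big_mkcond; apply: eq_bigr => j _.
rewrite cintZ ?cint_character; last exact: bounded_character.
by case: (e j == 0); rewrite ?mulr1 ?mulr0.
Qed.

Section unit_range.
Context (f : T -> R) (mf : measurable_fun setT f) (f01 : forall x, 0 <= f x <= 1).

Lemma bounded_unit_range : bounded_mfun f.
Proof.
by split => //; exists 1 => x; have /andP[f0 f1] := f01 x; rewrite ger0_norm.
Qed.

Let bf := bounded_unit_range.

Let fint n (e : 'I_n -> 'rV[int]_d) v :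
  mu.-integrable setT (EFin \o (fun x => f x * normsq (trig_sum e v x))).
Proof.
apply: bounded_mfun_integrable; apply: bounded_mfunM => //.
by apply: bounded_normsq; exact: bounded_trig_sum.
Qed.

Lemma qform_kernel_mx_ge0 n (e : 'I_n -> 'rV[int]_d) v :
  0 <= qform (kernel_mx f e) v.
Proof.
rewrite qform_kernel_mx// ler0c; apply: Rintegral_ge0 => x _.
by rewrite mulr_ge0 ?normsq_ge0//; have /andP[] := f01 x.
Qed.

Lemma qform_kernel_mx_le n (e : 'I_n -> 'rV[int]_d) v : injective e ->
  qform (kernel_mx f e) v <= \sum_i `|v i| ^+ 2.
Proof.
move=> ei; have b1 := bounded_mfun_cst T (1 : R).
(* Parseval: for distinct sites the kernel of the constant 1 is the identity matrix, so the
   comparison becomes f <= 1 under the integral. *)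
have -> : \sum_i `|v i| ^+ 2 = qform (kernel_mx (fun=> 1) e) v.
  apply: eq_bigr => i _; rewrite (bigD1 i)//= big1 ?addr0.
    by rewrite mxE fourier_coef1 subrr eqxx mulr1 normCK mulrC.
  by move=> j ji; rewrite mxE fourier_coef1 subr_eq0 (inj_eq ei) (negbTE ji) mulr0 mul0r.
rewrite !qform_kernel_mx// lecR; apply: le_Rintegral => //.
- apply: bounded_mfun_integrable; apply: bounded_mfunM => //.
  by apply: bounded_normsq; exact: bounded_trig_sum.
- move=> x _; rewrite mul1r ler_piMl ?normsq_ge0//.
  by have /andP[] := f01 x.
Qed.

End unit_range.
End kernel_form.

(** * Harmonic mean and weighted least squares *)

Section harmonic_mean.
Context (R : realType) (d : nat).
Local Notation T := (d.-tuple R).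
Local Notation mu := (torus_measure R d).
Context (f : T -> R) (mf : measurable_fun setT f) (f01 : forall x, 0 <= f x <= 1).

Definition inv_mass : \bar R := (\int[mu]_x ((f x)%:E)^-1)%E.

(** It increases to 1 / f and is bounded by n + 1, hence can be approximated in L^2 even when 1 / f
    is not integrable. *)
Definition shifted_inv (n : nat) (x : T) : R := (f x + n.+1%:R^-1)^-1.

Lemma shift_gt0 n x : 0 < f x + n.+1%:R^-1.
Proof. by rewrite ltr_wpDl ?invr_gt0// ?ltr0n//; have /andP[] := f01 x. Qed.

Lemma measurable_shifted_inv n : measurable_fun setT (shifted_inv n).
Proof.
rewrite (_ : shifted_inv n = fun x => (f x + n.+1%:R^-1) `^ (-1)).
  apply: (@measurableT_comp _ _ _ _ _ _ (@powR R ^~ (-1))) => //.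
  exact: measurable_funD.
by apply/funext => x; rewrite powR_inv1// ltW// shift_gt0.
Qed.

Lemma cvg_shifted_inv x :
  (shifted_inv n x)%:E @[n --> \oo] --> (((f x)%:E)^-1)%E.
Proof.
have /andP[f0 _] := f01 x.
have [fx0|fx0] := eqVneq (f x) 0.
  rewrite fx0 inve0 /shifted_inv fx0.
  under eq_fun do rewrite add0r invrK.
  by apply/cvgenyP; rewrite (cvg_shiftS (fun n => n)).
rewrite inver (negbTE fx0); apply: cvg_EFin; first by near=> n.
apply: cvgV => //; rewrite -[X in _ --> X]addr0.
by apply: cvgD; [exact: cvg_cst|exact: cvg_harmonic].
Unshelve. all: by end_near. Qed.

Lemma measurable_inve_density : measurable_fun setT (fun x : T => (((f x)%:E)^-1)%E).
Proof.
apply: (emeasurable_fun_cvg (fun n x => (shifted_inv n x)%:E)) => //.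
- by move=> n; apply/measurable_EFinP; exact: measurable_shifted_inv.
- by move=> x _; exact: cvg_shifted_inv.
Qed.

Lemma inve_density_ge0 (x : T) : (0 <= ((f x)%:E)^-1)%E.
Proof. by rewrite inve_ge0 lee_fin; have /andP[] := f01 x. Qed.

Lemma inv_mass_ge0 : (0 <= inv_mass)%E.
Proof. by apply: integral_ge0 => x _; exact: inve_density_ge0. Qed.

(** Only the infinite values need care: an infinite mass gives mean 0, and then p times it is at
    most 1 exactly when p = 0, by the convention that 0 times +oo is 0. *)
Lemma le_HM (p : R) : 0 <= p -> (p%:E <= HM f)%E <-> (p%:E * inv_mass <= 1)%E.
Proof.
move=> p0; rewrite /HM -/inv_mass.
have := inv_mass_ge0; case: inv_mass => [r| |]//; last first.
  move=> _; rewrite invey lee_fin. 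
  move: p0; rewrite le_eqVlt => /predU1P[<-|p0]; first by rewrite mul0e lexx.
  by rewrite gt0_muley ?lte_fin// leye_eq; split => // /(lt_le_trans p0); rewrite ltxx.
rewrite lee_fin => r0; move: (r0); rewrite le_eqVlt => /predU1P[<-|rp].
  by rewrite inve0 leey mule0 lee_fin ler01.
by rewrite inver gt_eqF// -EFinM !lee_fin -[r^-1]mul1r ler_pdivlMr.
Qed.

Lemma inv_mass_lim : (\int[mu]_x (shifted_inv n x)%:E)%E @[n --> \oo] --> inv_mass.
Proof.
rewrite (_ : inv_mass = \int[mu]_x (limn (fun n => (shifted_inv n x)%:E)))%E.
  apply: cvg_monotone_convergence => //.
  - by move=> n; apply/measurable_EFinP; exact: measurable_shifted_inv.
  - by move=> n x _; rewrite lee_fin invr_ge0 ltW// shift_gt0.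
  - move=> x _ m n mn; rewrite lee_fin lef_pV2 ?posrE ?shift_gt0// lerD2l.
    by rewrite lef_pV2 ?posrE ?ltr0n// ler_nat.
apply: eq_integral => x _; apply/esym/cvg_lim => //; exact: cvg_shifted_inv.
Qed.

(* Cauchy-Schwarz through 2 s U <= U^2 f + s^2 / f with s = p int U. *)
Lemma harmonic_cauchy_schwarz (p : R) (U : T -> R) : 0 <= p ->
  (p%:E * inv_mass <= 1)%E -> bounded_mfun U ->
  p * (\int[mu]_x U x) ^+ 2 <= \int[mu]_x (U x ^+ 2 * f x).
Proof.
move=> p0 pI bU.
have bf := bounded_unit_range mf f01.
have bU2f : bounded_mfun (fun x => U x ^+ 2 * f x).
  by apply: bounded_mfunM => //; exact: bounded_mfunM.
have rhs0 : 0 <= \int[mu]_x (U x ^+ 2 * f x).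
  by apply: Rintegral_ge0 => x _; rewrite mulr_ge0 ?sqr_ge0//; have /andP[] := f01 x.
move: p0; rewrite le_eqVlt => /predU1P[<-|p0]; first by rewrite mul0r.
have Ifin : inv_mass \is a fin_num.
  rewrite ge0_fin_numE ?inv_mass_ge0// ltNge leye_eq; apply/eqP => Iy.
  by move: pI; rewrite Iy gt0_muley ?lte_fin// leye_eq.
have iI : mu.-integrable setT (fun x => ((f x)%:E)^-1)%E.
  apply/integrableP; split; first exact: measurable_inve_density.
  under eq_integral do rewrite gee0_abs ?inve_density_ge0//.
  by rewrite -ge0_fin_numE ?inv_mass_ge0.
set u := \int[mu]_x U x; pose s := p * u.
have : (\int[mu]_x (2 * s * U x)%:E <=
  \int[mu]_x ((U x ^+ 2 * f x)%:E + (s ^+ 2)%:E * ((f x)%:E)^-1))%E.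
  apply: le_integral => //.
  - exact: (bounded_mfun_integrable mu (bounded_mfunM (bounded_mfun_cst T (2 * s)) bU)).
  - by apply: integrableD => //; [exact: bounded_mfun_integrable|exact: integrableZl].
  - move=> x _; have /andP[f0 _] := f01 x.
    (* Where f vanishes, the term with 1 / f is +oo unless s = 0, and in that case both sides are
       0. *)
    move: f0; rewrite le_eqVlt => /predU1P[<-|fx0].
      rewrite inve0 mulr0 add0e; have [->|s0] := eqVneq s 0.
        by rewrite mulr0 mul0r expr0n /= mul0e.
      by rewrite gt0_muley ?leey// lte_fin exprn_even_gt0.
    rewrite inver gt_eqF// -EFinM -EFinD lee_fin -subr_ge0.
    have -> : U x ^+ 2 * f x + s ^+ 2 / f x - 2 * s * U x =
      (U x * f x - s) ^+ 2 / f x by field; rewrite gt_eqF.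
    by rewrite divr_ge0 ?sqr_ge0// ltW.
rewrite integralD//; [|exact: bounded_mfun_integrable|exact: integrableZl].
rewrite integralZl//.
have -> : (\int[mu]_x (2 * s * U x)%:E = (2 * s)%:E * \int[mu]_x (U x)%:E)%E.
  under eq_integral do rewrite EFinM.
  by rewrite integralZl//; exact: bounded_mfun_integrable.
have EI (G : T -> R) : bounded_mfun G -> (\int[mu]_x (G x)%:E)%E = (\int[mu]_x G x)%:E.
  move=> bG; rewrite /Rintegral fineK//; apply: integrable_fin_num => //.
  exact: bounded_mfun_integrable.
rewrite !EI// -/inv_mass -(fineK Ifin) -!EFinM -EFinD lee_fin -/u.
move: pI; rewrite -(fineK Ifin) -EFinM lee_fin => pI h.
(* With s = p u the integrated inequality reads 2 p u^2 <= int U^2 f + p^2 u^2 I, where I is the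
   mass; p I <= 1 bounds the last term by p u^2. *)
have : s ^+ 2 * fine inv_mass <= p * u ^+ 2.
  rewrite /s exprMn -mulrA (mulrC (u ^+ 2)) mulrA expr2 -(mulrA p p) -mulrA.
  by rewrite ler_pM2l// -[leRHS]mul1r ler_wpM2r ?sqr_ge0.
move: h; rewrite /s; nra.
Qed.

End harmonic_mean.

(** * Density of trigonometric polynomials *)

Lemma sqrD_le (R : realFieldType) (a b : R) :
  (a + b) ^+ 2 <= 2 * a ^+ 2 + 2 * b ^+ 2.
Proof.
rewrite -subr_ge0 (_ : _ - _ = (a - b) ^+ 2) ?sqr_ge0//; ring.
Qed.

Section trig_poly.
Context (R : realType) (d : nat).
Local Notation C := (complex R).
Local Notation T := (d.-tuple R).
Local Notation mu := (torus_measure R d).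

(** Frequencies may repeat in the list, so that sums are concatenations and products are pairings;
    [trig_poly_sum] merges the repetitions. *)
Definition trig_poly (U : T -> R) := exists s : seq (C * 'rV[int]_d),
  forall x, (U x)%:C%C = \sum_(u <- s) u.1 * character u.2 x.

Lemma trig_poly_cst c : trig_poly (fun=> c).
Proof.
by exists [:: (c%:C%C, 0)] => x; rewrite big_seq1 character0 mulr1.
Qed.

Lemma trig_polyD U V : trig_poly U -> trig_poly V -> trig_poly (fun x => U x + V x).
Proof.
by move=> [s Us] [t Vt]; exists (s ++ t) => x; rewrite rmorphD /= Us Vt big_cat.
Qed.

Lemma trig_polyM U V : trig_poly U -> trig_poly V -> trig_poly (fun x => U x * V x).
Proof.
move=> [s Us] [t Vt].
exists [seq (u.1 * v.1, u.2 + v.2) | u <- s, v <- t] => x.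
rewrite rmorphM /= Us Vt big_allpairs_dep mulr_suml; apply: eq_bigr => u _.
by rewrite mulr_sumr; apply: eq_bigr => v _ /=; rewrite characterD; ring.
Qed.

Lemma trig_polyB U V : trig_poly U -> trig_poly V -> trig_poly (fun x => U x - V x).
Proof.
move=> tU tV; rewrite (_ : (fun x => _) = fun x => U x + -1 * V x).
  by apply: trig_polyD => //; apply: trig_polyM => //; exact: trig_poly_cst.
by apply/funext => x; rewrite mulN1r.
Qed.

Lemma trig_polyX U n : trig_poly U -> trig_poly (fun x => U x ^+ n).
Proof.
move=> tU; elim: n => [|n IH]; first exact: trig_poly_cst.
rewrite (_ : (fun x => _) = fun x => U x * U x ^+ n); first exact: trig_polyM.
by apply/funext => x; rewrite exprS.
Qed.

Lemma trig_poly_cos (i : 'I_d) (a : R) : trig_poly (fun x => cos (2 * pi * tnth x i - a)).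
Proof.
pose k : 'rV[int]_d := delta_mx ord0 i.
exists [:: (expi (- a) / 2, k); (expi a / 2, - k)] => x.
rewrite big_cons big_seq1 characterN /=.
have -> : character k x = expi (2 * pi * tnth x i).
  rewrite /character /dotZ (bigD1 i)//= big1 ?addr0; last first.
    by move=> j ji; rewrite mxE eqxx (negbTE ji) mul0r.
  by rewrite mxE !eqxx mul1r.
have cosE t : (cos t)%:C%C = (expi t + (expi t)^*) / 2.
  by rewrite -[RHS]/((_ + _) / 2) addcJ mulrC mulKf ?pnatr_eq0.
by rewrite cosE expiD rmorphM /= -(expiN (- a)) opprK; ring.
Qed.

Lemma bounded_trig_poly U : trig_poly U -> bounded_mfun U.
Proof.
move=> [s Us].
have [bRe _] : bounded_cmfun (fun x : T => \sum_(u <- s) u.1 * character u.2 x).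
  apply: bounded_cmfun_sum => u; apply: bounded_cmfunM; first exact: bounded_cmfun_cst.
  exact: bounded_character.
rewrite [X in bounded_mfun X](_ : _ =
  (fun x => complex.Re (\sum_(u <- s) u.1 * character u.2 x)))//.
by apply/funext => x; rewrite -Us.
Qed.

Definition L2_trig_approx (G : T -> R) := bounded_mfun G /\
  forall e, 0 < e -> exists2 U, trig_poly U & \int[mu]_x (G x - U x) ^+ 2 < e.

Lemma trig_poly_approx U : trig_poly U -> L2_trig_approx U.
Proof.
move=> tU; split; first exact: bounded_trig_poly.
move=> e e0; exists U => //.
by under eq_Rintegral do rewrite subrr expr0n; rewrite Rintegral_prob_cst.
Qed.

Let bint := bounded_mfun_integrable mu.

Let bsqB (F G : T -> R) : bounded_mfun F -> bounded_mfun G ->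
  bounded_mfun (fun x : T => (F x - G x) ^+ 2).
Proof.
by move=> bF bG; apply: bounded_mfunM; exact: bounded_mfunB.
Qed.

Lemma L2_trig_approx_trans G : bounded_mfun G ->
  (forall e, 0 < e -> exists2 H, L2_trig_approx H & \int[mu]_x (G x - H x) ^+ 2 < e) ->
  L2_trig_approx G.
Proof.
(* Each of the two errors is doubled by (a + b)^2 <= 2 a^2 + 2 b^2, whence e / 4. *)
move=> bG h; split => // e e0; have e4 : 0 < e / 4 by rewrite divr_gt0.
have [H [bH aH] GH] := h _ e4; have [U tU HU] := aH _ e4; exists U => //.
have bU := bounded_trig_poly tU.
apply: (@le_lt_trans _ _ (\int[mu]_x (2 * (G x - H x) ^+ 2 + 2 * (H x - U x) ^+ 2))).
  have b2 (F : T -> R) : bounded_mfun F -> bounded_mfun (fun x : T => 2 * F x).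
    by move=> bF; apply: bounded_mfunM => //; exact: bounded_mfun_cst.
  apply: le_Rintegral => //.
  - exact: bint (bsqB bG bU).
  - by apply: bint (bounded_mfunD (b2 _ (bsqB bG bH)) (b2 _ (bsqB bH bU))).
  - by move=> x _; rewrite -(subrKA (H x)) sqrD_le.
have ib2 (F : T -> R) : bounded_mfun F -> mu.-integrable setT (EFin \o (fun x : T => 2 * F x)).
  by move=> bF; apply: bint; apply: bounded_mfunM => //; exact: bounded_mfun_cst.
rewrite (RintegralD measurableT (ib2 _ (bsqB bG bH)) (ib2 _ (bsqB bH bU))).
rewrite (RintegralZl _ measurableT (bint (bsqB bG bH))).
rewrite (RintegralZl _ measurableT (bint (bsqB bH bU))).
lra.
Qed.

Lemma L2_trig_approxD F G : L2_trig_approx F -> L2_trig_approx G ->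
  L2_trig_approx (fun x => F x + G x).
Proof.
move=> [bF aF] [bG aG]; split; first exact: bounded_mfunD.
move=> e e0; have e4 : 0 < e / 4 by rewrite divr_gt0.
have [U tU FU] := aF _ e4; have [V tV GV] := aG _ e4.
exists (fun x => U x + V x); first exact: trig_polyD.
have bU := bounded_trig_poly tU; have bV := bounded_trig_poly tV.
have b2 (H : T -> R) : bounded_mfun H -> bounded_mfun (fun x : T => 2 * H x).
  by move=> bH; apply: bounded_mfunM => //; exact: bounded_mfun_cst.
apply: (@le_lt_trans _ _ (\int[mu]_x (2 * (F x - U x) ^+ 2 + 2 * (G x - V x) ^+ 2))).
  apply: le_Rintegral => //.
  - exact: bint (bsqB (bounded_mfunD bF bG) (bounded_mfunD bU bV)).
  - exact: bint (bounded_mfunD (b2 _ (bsqB bF bU)) (b2 _ (bsqB bG bV))).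
  - by move=> x _; rewrite opprD addrACA sqrD_le.
rewrite (RintegralD measurableT (bint (b2 _ (bsqB bF bU))) (bint (b2 _ (bsqB bG bV)))).
rewrite (RintegralZl _ measurableT (bint (bsqB bF bU))).
rewrite (RintegralZl _ measurableT (bint (bsqB bG bV))).
lra.
Qed.

Lemma L2_trig_approxZ c F : L2_trig_approx F -> L2_trig_approx (fun x => c * F x).
Proof.
move=> [bF aF]; have bZ (H : T -> R) : bounded_mfun H -> bounded_mfun (fun x : T => c * H x).
  by move=> bH; apply: bounded_mfunM => //; exact: bounded_mfun_cst.
split; first exact: bZ.
(* The error is scaled by c^2; dividing by c^2 + 1 instead also covers c = 0. *)
move=> e e0; have c1 : 0 < c ^+ 2 + 1 by rewrite ltr_wpDl ?sqr_ge0.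
have ec : 0 < e / (c ^+ 2 + 1) by rewrite divr_gt0.
have [U tU FU] := aF _ ec; have bU := bounded_trig_poly tU.
exists (fun x => c * U x); first by apply: trig_polyM => //; exact: trig_poly_cst.
under eq_Rintegral do rewrite -mulrBr exprMn.
rewrite (RintegralZl _ measurableT (bint (bsqB bF bU))).
have i0 : 0 <= \int[mu]_x (F x - U x) ^+ 2.
  by apply: Rintegral_ge0 => x _; exact: sqr_ge0.
apply: (@le_lt_trans _ _ ((c ^+ 2 + 1) * \int[mu]_x (F x - U x) ^+ 2)).
  by rewrite ler_wpM2r// lerDl.
by rewrite mulrC -ltr_pdivlMr.
Qed.

(** Dominated convergence: if [N] bounds the limit, the squared differences are at most (N +
    M)^2. *)
Lemma L2_trig_approx_cvg (G_ : nat -> T -> R) (G : T -> R) (M : R) : bounded_mfun G ->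
  (forall n, L2_trig_approx (G_ n)) -> (forall n x, `|G_ n x| <= M) ->
  {ae mu, forall x, G_ n x @[n --> \oo] --> G x} ->
  L2_trig_approx G.
Proof.
move=> bG aG G_M G_G; apply: L2_trig_approx_trans => // e e0.
have [N GN] := bG.2.
have b n : bounded_mfun (fun x => (G x - G_ n x) ^+ 2) by exact: bsqB bG (aG n).1.
have m n : measurable_fun setT (fun x => ((G x - G_ n x) ^+ 2)%:E).
  by apply/measurable_EFinP; exact: (b n).1.
have lim0 : {ae mu, forall x, setT x -> ((G x - G_ n x) ^+ 2)%:E @[n --> \oo] --> 0%E}.
  apply: filterS G_G => x Gx _; apply: cvg_EFin; first by near=> n.
  have h : G x - G_ n x @[n --> \oo] --> 0.
    by rewrite -[X in _ --> X](subrr (G x)); apply: cvgB => //; exact: cvg_cst.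
  have h2 : (G x - G_ n x) * (G x - G_ n x) @[n --> \oo] --> 0.
    by rewrite -[X in _ --> X](mulr0 0); exact: cvgM.
  rewrite [X in X @ _](_ : _ = fun n => (G x - G_ n x) * (G x - G_ n x))//.
have ig : mu.-integrable setT (cst ((N + M) ^+ 2)%:E).
  exact: (bint (bounded_mfun_cst T ((N + M) ^+ 2))).
have le : {ae mu, forall x n, setT x ->
    (`|((G x - G_ n x) ^+ 2)%:E| <= cst ((N + M) ^+ 2)%:E x)%E}.
  apply: aeW => x n _ /=; rewrite lee_fin normrX lerXn2r ?nnegrE//.
    by rewrite (le_trans _ (lerD (GN x) (G_M n x)))// addr_ge0.
  by rewrite (le_trans (ler_normB _ _))// lerD.
have [_ _] := @dominated_convergence _ _ _ mu setT measurableT _ (cst 0%E) _ m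
  (measurable_cst _) lim0 ig le.
rewrite integral0 => /(_ [set y | (y < e%:E)%E]) [].
  by apply: open_nbhs_nbhs; split; [exact: open_ereal_lt_ereal|rewrite /= lte_fin].
move=> n _ /(_ n (leqnn n)) /= Gn; exists (G_ n) => //.
rewrite -lte_fin /Rintegral fineK//.
by apply: integrable_fin_num => //; exact: bint (b n).
Unshelve. all: by end_near. Qed.

End trig_poly.

(** * One-coordinate marginals of the torus measure *)

Section marginals.
Context (R : realType).
Local Notation U := (uniform_prob (@ltr01 R)).

Lemma torus_marginal d (i : 'I_d) (B : set R) : measurable B ->
  torus_measure R d [set x | B (tnth x i)] = U B.
Proof.
elim: d i => [|d IH] i mB; first by case: i.
rewrite -[LHS]/((U \x torus_measure R d)%E [set z | B (tnth (tuple_cons z) i)]).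
case: (unliftP ord0 i) => [j ->|->].
  rewrite (_ : [set z | _] = setT `*` [set y | B (tnth y j)]); last first.
    by apply/seteqP; split=> -[x y]; rewrite /= tnthS; [|case].
  rewrite product_measure1E//; last first.
    by rewrite -[X in measurable X]setTI; exact: measurable_tnth.
  by rewrite [X in (X * _)%E]probability_setT mul1e; exact: IH.
rewrite (_ : [set z | _] = B `*` setT); last first.
  by apply/seteqP; split=> -[x y] //= [].
rewrite product_measure1E//.
by rewrite [X in (_ * X)%E]probability_setT mule1.
Qed.

Lemma uniform_prob_set1 t : U [set t] = 0%E.
Proof.
have := @dominates_uniform_prob R 0 1 ltr01.
move/null_content_dominatesP => /(_ [set t]); apply => //.
exact: lebesgue_measure_set1.
Qed.

Lemma uniform_prob_out : U (~` `[0, 1]) = 0%E.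
Proof.
have U1 : U `[0, 1]%classic = 1%E.
  rewrite /uniform_prob; exact: integral_uniform_pdf1.
have -> : U (~` `[0, 1]) = (1 - U `[0%R, 1%R]%classic)%E by exact: probability_setC.
by rewrite U1 subee.
Qed.

(** This discards the points where the approximation of a half-space breaks down: the endpoints,
    which a periodic function cannot tell apart, and the threshold itself. *)
Lemma ae_torus_unit d (i : 'I_d) (t : R) :
  {ae torus_measure R d, forall x, 0 < tnth x i < 1 /\ tnth x i != t}.
Proof.
pose B := (~` `[0, 1]) `|` [set (0:R)] `|` [set (1:R)] `|` [set t].
have mB : measurable B by do 3 apply: measurableU => //; exact: measurableC.
exists [set x | B (tnth x i)]; split.
- by rewrite -[X in measurable X]setTI; exact: measurable_tnth.
- rewrite torus_marginal//.
  have U0 A A' : measurable A -> measurable A' -> U A = 0%E -> U A' = 0%E -> U (A `|` A') = 0%E.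
    by move=> mA mA' A0 A'0; apply: null_set_setU.
  by rewrite /B !U0 ?uniform_prob_set1 ?uniform_prob_out//;
    do ?apply: measurableU => //; exact: measurableC.
- move=> x /= h; apply: contrapT => nB; apply: h.
  move/not_orP : nB => [/not_orP[/not_orP[/contrapT x01 x0] x1] xt].
  move: x01; rewrite /= in_itv/= => /andP[]; rewrite !le_eqVlt.
  move=> /predU1P[x0'|->]; first by exfalso; apply: x0.
  move=> /predU1P[x1'|->]; first by exfalso; apply: x1.
  by split => //; apply/eqP.
Qed.

End marginals.

(* Brosowski-Deutsch polynomials approximating a step at 1/2. *)
Section step.
Context (R : realType).

Definition step_poly (n : nat) (u : R) : R := (1 - u ^+ n) ^+ (2 ^ n).

Lemma step_poly01 n u : 0 <= u <= 1 -> 0 <= step_poly n u <= 1.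
Proof.
move=> /andP[u0 u1]; have un : 0 <= 1 - u ^+ n by rewrite subr_ge0 exprn_ile1.
by rewrite exprn_ge0//= exprn_ile1// gerBl exprn_ge0.
Qed.

Lemma bernoulli_ge (y : R) k : 0 <= y <= 1 -> 1 - k%:R * y <= (1 - y) ^+ k.
Proof.
move=> /andP[y0 y1]; elim: k => [|k IH]; first by rewrite mul0r subr0.
rewrite exprS; apply: le_trans (ler_wpM2l _ IH); last by rewrite subr_ge0.
by rewrite -natr1 -subr_ge0 (_ : _ - _ = k%:R * y ^+ 2) ?mulr_ge0 ?sqr_ge0//; ring.
Qed.

Lemma bernoulli_le (y : R) k : 0 <= y <= 1 -> (1 - y) ^+ k * (1 + k%:R * y) <= 1.
Proof.
move=> /andP[y0 y1]; elim: k => [|k IH]; first by rewrite mul0r addr0 mul1r.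
apply: le_trans IH; rewrite exprSr -mulrA ler_wpM2l ?exprn_ge0 ?subr_ge0//.
rewrite -natr1 -subr_ge0.
by rewrite (_ : _ - _ = (k%:R + 1) * y ^+ 2) ?mulr_ge0 ?sqr_ge0 ?addr_ge0//; ring.
Qed.

(** Both Bernoulli bounds are governed by 2^n u^n = (2 u)^n, which tends to 0 below 1/2 and to
    infinity above it. *)
Lemma cvg_step_poly (u : R) : 0 <= u <= 1 -> u != 2^-1 ->
  step_poly n u @[n --> \oo] --> (if u < 2^-1 then 1 else 0 : R).
Proof.
move=> u01 uh; have /andP[u0 u1] := u01.
have un n : 0 <= u ^+ n <= 1 by rewrite exprn_ge0//= exprn_ile1.
have E2 n : (2 ^ n)%:R * u ^+ n = (2 * u) ^+ n by rewrite natrX exprMn.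
move: uh; rewrite neq_lt => /orP[uh|uh].
- rewrite uh /=; apply: (@squeeze_cvgr _ _ _ _ (fun n => 1 - (2 * u) ^+ n) (cst 1)).
  + near=> n; have := bernoulli_ge (2 ^ n) (un n); rewrite E2 => ->.
    by have /andP[] := step_poly01 n u01.
  + rewrite -[X in _ --> X]subr0; apply: cvgB; first exact: cvg_cst.
    apply: cvg_expr; rewrite ger0_norm ?mulr_ge0//; lra.
  + exact: cvg_cst.
- rewrite ltNge (ltW uh) /=; apply: (@squeeze_cvgr _ _ _ _ (cst 0) (fun n => (2 * u)^-1 ^+ n)).
  + near=> n; have /andP[-> _] := step_poly01 n u01.
    rewrite exprVn -[leRHS]mul1r ler_pdivlMr; last by rewrite exprn_gt0// mulr_gt0//; lra.
    apply: le_trans (bernoulli_le (2 ^ n) (un n)); rewrite E2 ler_wpM2l//.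
      by have /andP[] := step_poly01 n u01.
    by rewrite lerDr.
  + exact: cvg_cst.
  + apply: cvg_expr; rewrite ger0_norm ?invr_ge0 ?mulr_ge0// invf_lt1; lra.
Unshelve. all: by end_near. Qed.

End step.

(** * From half-spaces to bounded measurable functions *)

Section density.
Context (R : realType) (d : nat).
Local Notation T := (d.-tuple R).
Local Notation mu := (torus_measure R d).

(** On the circle, 0 < x < t is the open arc of half-width pi t centred at the angle pi t, and an
    arc is a superlevel set of the cosine of the angle to its centre. *)
Lemma cos_lt_arc (t x : R) : 0 < t < 1 -> 0 < x < 1 -> x != t ->
  (cos (pi * t) < cos (2 * pi * x - pi * t)) = (x < t) /\
  cos (2 * pi * x - pi * t) != cos (pi * t).
Proof.
move=> /andP[t0 t1] /andP[x0 x1] xt; have pi0 := pi_gt0 R.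
have mulpi (y : R) : 0 <= y <= 1 -> pi * y \in `[0, pi].
  move=> /andP[y0 y1]; rewrite in_itv /=; apply/andP; split.
    by rewrite mulr_ge0// ltW.
  by rewrite ler_piMr// ltW.
have tpi : pi * t \in `[0, pi] by apply: mulpi; rewrite !ltW.
have -> : 2 * pi * x - pi * t = pi * (2 * x - t) by ring.
(* [y] is 2 x - t folded into [0, 1] by parity and by period 2, so that the cosine is compared where
   it is decreasing. *)
suff [y [y01 -> yt]] : exists y, [/\ 0 <= y <= 1, cos (pi * (2 * x - t)) = cos (pi * y) &
    (if x < t then y < t else t < y)].
  have ypi := mulpi _ y01.
  rewrite ltr_cos// ltr_pM2l//; move: yt; case: ifPn => [_ yt|_ ty].
    by rewrite yt; split => //; rewrite gt_eqF// ltr_cos// ltr_pM2l.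
  by rewrite ltNge (ltW ty); split => //; rewrite lt_eqF// ltr_cos// ltr_pM2l.
have [xt'|tx] := ltP x t.
  exists `|2 * x - t|; split.
  - by rewrite normr_ge0/= ler_norml; lra.
  - by case: (ger0P (2 * x - t)) => _ //; rewrite mulrN cosN.
  - by rewrite ltr_norml; lra.
have {}tx : t < x by rewrite lt_neqAle eq_sym xt.
have [h|h] := leP (2 * x - t) 1.
  by exists (2 * x - t); split => //; lra.
exists (2 - (2 * x - t)); split; [lra| |lra].
have -> : pi * (2 - (2 * x - t)) = - (pi * (2 * x - t)) + pi *+ 2 by rewrite -mulr_natr; ring.
by rewrite cosD2pi cosN.
Qed.

(** Limits almost everywhere of approximants in [0, 1] can be multiplied, which makes these sets a
    pi-system; L^2 approximability alone has no such product rule. *)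
Definition trig_indicator (A : set T) := measurable A /\
  exists U_ : nat -> T -> R, [/\ forall n, trig_poly (U_ n),
    forall n x, 0 <= U_ n x <= 1 &
    {ae mu, forall x, U_ n x @[n --> \oo] --> (\1_A x : R)}].

Lemma trig_indicatorI A B : trig_indicator A -> trig_indicator B ->
  trig_indicator (A `&` B).
Proof.
move=> [mA [U_ [tU U01 UA]]] [mB [V_ [tV V01 VB]]]; split; first exact: measurableI.
exists (fun n x => U_ n x * V_ n x); split.
- by move=> n; exact: trig_polyM.
- move=> n x; have /andP[u0 u1] := U01 n x; have /andP[v0 v1] := V01 n x.
  by rewrite mulr_ge0//= mulr_ile1.
- apply: filterS2 UA VB => x Ux Vx; rewrite indicI; exact: cvgM.
Qed.

Lemma trig_indicator_cst (A : set T) (c : bool) : measurable A ->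
  {ae mu, forall x, (x \in A) = c} -> trig_indicator A.
Proof.
move=> mA Ac; split => //; exists (fun _ _ => c%:R); split.
- by move=> n; exact: trig_poly_cst.
- by move=> n x; case: c Ac => _; rewrite ?lexx ?ler01.
- by apply: filterS Ac => x; rewrite indicE => ->; exact: cvg_cst.
Qed.

Lemma trig_indicator_halfspace (i : 'I_d) (t : R) :
  trig_indicator [set x | tnth x i < t].
Proof.
have mA : measurable [set x : T | tnth x i < t].
  rewrite -[X in measurable X]setTI (_ : [set x : T | _] =
    (fun x : T => tnth x i) @^-1` `]-oo, t[).
    exact: measurable_tnth.
  by apply/seteqP; split=> x /=; rewrite in_itv.
have [t0|t0] := leP t 0.
  apply: (@trig_indicator_cst _ false) => //.
  apply: filterS (ae_torus_unit i 0) => x [/andP[x0 _] _].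
  by apply/negbTE; rewrite notin_setE /=; apply/negP; rewrite -leNgt (le_trans t0)// ltW.
have [t1|t1] := leP 1 t.
  apply: (@trig_indicator_cst _ true) => //.
  apply: filterS (ae_torus_unit i 0) => x [/andP[_ x1] _].
  by rewrite mem_set //=; exact: lt_le_trans t1.
have t01 : 0 < t < 1 by rewrite t0.
split => //.
(* u - 1/2 is a quarter of cos(pi t) - cos(2 pi x_i - pi t): its sign detects the arc, and the
   factor 1/4 keeps u in [0, 1]. *)
pose u (x : T) : R :=
  1 / 2 + cos (pi * t) / 4 - 1 / 4 * cos (2 * pi * tnth x i - pi * t).
have tu : trig_poly u.
  apply: trig_polyB; first exact: trig_poly_cst.
  by apply: trig_polyM; [exact: trig_poly_cst|exact: trig_poly_cos].
have u01 x : 0 <= u x <= 1.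
  have c1 := cos_le1 (2 * pi * tnth x i - pi * t).
  have c2 := cos_geN1 (2 * pi * tnth x i - pi * t).
  have c3 := cos_le1 (pi * t).
  have c4 := cos_geN1 (pi * t).
  by rewrite /u; lra.
exists (fun n x => step_poly n (u x)); split.
- move=> n; apply: trig_polyX; apply: trig_polyB; first exact: trig_poly_cst.
  exact: trig_polyX.
- by move=> n x; exact: step_poly01.
- apply: filterS (ae_torus_unit i t) => x [x01 xt].
  have [c1 c2] := cos_lt_arc t01 x01 xt.
  have -> : \1_[set x : T | tnth x i < t] x = if u x < 2^-1 then 1 else 0 :> R.
    have -> : (u x < 2^-1) = (tnth x i < t) by rewrite -c1 /u; apply/idP/idP; lra.
    rewrite indicE; case: ifPn => h; first by rewrite mem_set.
    by rewrite memNset //=; exact/negP.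
  apply: cvg_step_poly => //; apply: contra c2 => /eqP; rewrite /u => h; apply/eqP; lra.
Qed.

Lemma measurable_trig_indicator (A : set T) :
  measurable A -> <<s trig_indicator >> A.
Proof.
pose TG := g_sigma_algebraType trig_indicator.
move=> mA; suff mid : measurable_fun [set: TG] (fun x : TG => x : T).
  by have := mid measurableT A mA; rewrite setTI.
apply/measurable_fun_tnthP => i.
apply: (measurability _ (RGenInftyO.measurableE R)) => _ [_ [t ->] <-].
rewrite setTI; apply: sub_sigma_algebra.
rewrite (_ : _ @^-1` _ = [set x | tnth x i < t]); first exact: trig_indicator_halfspace.
by apply/seteqP; split=> x /=; rewrite in_itv.
Qed.

Lemma bounded_indic dS (S : measurableType dS) (A : set S) : measurable A ->
  bounded_mfun (\1_A : S -> R).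
Proof.
move=> mA; split; first exact: measurable_indic.
by exists 1 => x; rewrite indicE; case: (x \in A); rewrite /= ?normr1 ?normr0.
Qed.

Lemma L2_trig_approx_indic (A : set T) : measurable A -> L2_trig_approx (\1_A : T -> R).
Proof.
move=> mA; suff : measurable A /\ L2_trig_approx (\1_A : T -> R) by case.
move: A {mA} (measurable_trig_indicator mA).
apply: lambda_system_subset => //.
- by move=> A B; exact: trig_indicatorI.
- split => //.
  + split => //; rewrite indicT; apply: trig_poly_approx; exact: trig_poly_cst.
  + move=> A B BA [mA aA] [mB aB]; split; first exact: measurableD.
    rewrite (_ : \1_ _ = fun x => (\1_A x : R) + -1 * \1_B x); last first.
      apply/funext => x; rewrite !indicE in_setD mulN1r.
      have [Bx|Bx] := boolP (x \in B); last by rewrite andbT oppr0 addr0.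
      by rewrite (_ : x \in A) ?subrr//; move: Bx; rewrite !inE; exact: BA.
    by apply: L2_trig_approxD => //; exact: L2_trig_approxZ.
  + move=> F ndF aF; have mF i : measurable (F i) by have [] := aF i.
    split; first exact: bigcupT_measurable.
    apply: (@L2_trig_approx_cvg _ _ (fun n => \1_(F n)) _ 1).
    * by apply: bounded_indic; exact: bigcupT_measurable.
    * by move=> n; have [] := aF n.
    * by move=> n x; rewrite indicE; case: (x \in _); rewrite /= ?normr1 ?normr0.
    * apply: aeW => x; rewrite indicE; case: (boolP (x \in _)) => xF.
        move: xF; rewrite inE => -[k _ Fkx]; apply: cvg_near_cst.
        near=> n; apply/eqP; rewrite indicE mem_set//.
        have kn : (k <= n)%N by near: n; exact: nbhs_infty_ge.
        by move/subsetPset: (ndF _ _ kn); exact.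
      apply: cvg_near_cst; near=> n; apply/eqP; rewrite indicE memNset// => Fnx.
      by move/negP: xF; apply; rewrite inE; exists n.
- move=> A [mA [U_ [tU U01 UA]]]; split => //.
  apply: (@L2_trig_approx_cvg _ _ U_ _ 1) => //.
  + exact: bounded_indic.
  + by move=> n; exact: trig_poly_approx.
  + by move=> n x; have /andP[? ?] := U01 n x; rewrite ger0_norm.
Unshelve. all: by end_near. Qed.

Import HBNNSimple.

Lemma L2_trig_approx_bounded (G : T -> R) : bounded_mfun G -> (forall x, 0 <= G x) ->
  L2_trig_approx G.
Proof.
move=> bG G0; have [mG [M GM]] := bG.
have mEG : measurable_fun setT (EFin \o G) by exact/measurable_EFinP.
pose G_ := nnsfun_approx measurableT mEG.
have G_G x : EFin (G_ n x) @[n --> \oo] --> (G x)%:E.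
  by apply: (@cvg_nnsfun_approx _ _ _ _ measurableT _ mEG) => // y _; rewrite lee_fin.
have G_le n x : G_ n x <= G x.
  have nd : nondecreasing_seq (fun n => G_ n x).
    by move=> i j ij; exact/lefP/nd_nnsfun_approx.
  have cG : G_ n x @[n --> \oo] --> G x.
    by move/fine_cvgP : (G_G x) => [_].
  have cvgG : cvgn (fun n => G_ n x) by exact: cvgP cG.
  by have := nondecreasing_cvgn_le nd cvgG n; rewrite (cvg_lim _ cG).
apply: (@L2_trig_approx_cvg _ _ (fun n => G_ n) _ M) => //.
- move=> n.
  rewrite (_ : (G_ n : T -> R) = fun x =>
    \sum_(y <- finmap.enum_fset (fset_set (range (G_ n)))) y * \1_(G_ n @^-1` [set y]) x).
    elim: (finmap.enum_fset _) => [|y s IH].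
      rewrite (_ : (fun x => _) = fun=> 0); first exact/trig_poly_approx/trig_poly_cst.
      by apply/funext => x; rewrite big_nil.
    rewrite (_ : (fun x => _) = fun x => y * \1_(G_ n @^-1` [set y]) x +
        \sum_(y <- s) y * \1_(G_ n @^-1` [set y]) x); last first.
      by apply/funext => x; rewrite big_cons.
    by apply: L2_trig_approxD => //; apply: L2_trig_approxZ; exact: L2_trig_approx_indic.
  by apply/funext => x; rewrite [LHS]fimfunE fsbig_finite.
- by move=> n x; rewrite ger0_norm// (le_trans (G_le n x))// (le_trans _ (GM x))// ler_norm.
- by apply: aeW => x; move/fine_cvgP : (G_G x) => [_].
Qed.

End density.

(** * The extremal problem behind the harmonic mean *)

Section extremal.
Context (R : realType) (d : nat).
Local Notation C := (complex R).
Local Notation T := (d.-tuple R).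
Local Notation mu := (torus_measure R d).
Context (f : T -> R) (mf : measurable_fun setT f) (f01 : forall x, 0 <= f x <= 1).

Let bint := bounded_mfun_integrable mu.

(** The variance of [D] is nonnegative. *)
Lemma sqr_Rintegral_le (D : T -> R) : bounded_mfun D ->
  (\int[mu]_x D x) ^+ 2 <= \int[mu]_x D x ^+ 2.
Proof.
move=> bD; set m := \int[mu]_x D x.
have bD2 : bounded_mfun (fun x => D x ^+ 2) by exact: bounded_mfunM.
have b2D : bounded_mfun (fun x => (2 * m) * D x).
  by apply: bounded_mfunM => //; exact: bounded_mfun_cst.
have bm := bounded_mfun_cst T (m ^+ 2).
have : 0 <= \int[mu]_x ((D x ^+ 2 - (2 * m) * D x) + m ^+ 2).
  apply: Rintegral_ge0 => x _.
  rewrite (_ : _ + _ = (D x - m) ^+ 2) ?sqr_ge0//; ring.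
rewrite (RintegralD measurableT (bint (bounded_mfunB bD2 b2D)) (bint bm)).
rewrite (RintegralB measurableT (bint bD2) (bint b2D)).
rewrite (RintegralZl _ measurableT (bint bD)) Rintegral_prob_cst -/m.
lra.
Qed.

(* The minimiser of int U^2 h subject to int U = 1 is proportional to 1/h. *)
Lemma shifted_inv_bound (p : R) n : 0 <= p ->
  (forall U, trig_poly U -> p * (\int[mu]_x U x) ^+ 2 <= \int[mu]_x (U x ^+ 2 * f x)) ->
  p * \int[mu]_x shifted_inv f n x <= 1.
Proof.
move=> p0 pU; set G := shifted_inv f n; set g := \int[mu]_x G x.
have n0 : 0 < n.+1%:R^-1 :> R by rewrite invr_gt0 ltr0n.
have n1 : n.+1%:R^-1 <= 1 :> R by rewrite invf_le1 ?ltr0n// ler1n.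
have h0 x : 0 < f x + n.+1%:R^-1 by exact: shift_gt0.
have G0 x : 0 < G x by rewrite invr_gt0.
have bG : bounded_mfun G.
  split; first exact: measurable_shifted_inv.
  exists n.+1%:R => x; rewrite ger0_norm; last exact: ltW.
  rewrite /G /shifted_inv -[leRHS]invrK lef_pV2 ?posrE//.
  by rewrite lerDr; have /andP[] := f01 x.
have g0 : 0 <= g by apply: Rintegral_ge0 => x _; exact: ltW.
(* The hypothesis is tested on a trigonometric U within [eta] of G in L^2; [t] is the error in the
   mean, so that int U = g - t. *)
have key eta : 0 < eta -> exists t, [/\ t ^+ 2 <= eta ^+ 2 &
    p * (g - t) ^+ 2 <= g - 2 * t + 2 * eta ^+ 2].
  move=> e0; have [_ aG] := L2_trig_approx_bounded bG (fun x => ltW (G0 x)).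
  have [U tU GU] := aG _ (exprn_gt0 2 e0).
  have bU := bounded_trig_poly tU; have bGU := bounded_mfunB bG bU.
  have bGU2 : bounded_mfun (fun x => (G x - U x) ^+ 2) by exact: bounded_mfunM.
  exists (g - \int[mu]_x U x); split.
    rewrite -(RintegralB measurableT (bint bG) (bint bU)).
    exact: le_trans (sqr_Rintegral_le bGU) (ltW GU).
  rewrite subKr; apply: le_trans (pU _ tU) _.
  have b2U : bounded_mfun (fun x => 2 * U x).
    by apply: bounded_mfunM => //; exact: bounded_mfun_cst.
  have b2GU : bounded_mfun (fun x => 2 * (G x - U x) ^+ 2).
    by apply: bounded_mfunM => //; exact: bounded_mfun_cst.
  have bU2f : bounded_mfun (fun x => U x ^+ 2 * f x).
    by apply: bounded_mfunM; [exact: bounded_mfunM|exact: bounded_unit_range].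
  apply: (@le_trans _ _ (\int[mu]_x ((2 * U x - G x) + 2 * (G x - U x) ^+ 2))).
    apply: le_Rintegral => //.
    - exact: bint bU2f.
    - exact: bint (bounded_mfunD (bounded_mfunB b2U bG) b2GU).
    - move=> x _; have /andP[f0 f1] := f01 x.
      have Gh : G x * (f x + n.+1%:R^-1) = 1 by rewrite mulVf// gt_eqF.
      set k := n.+1%:R^-1 in n0 n1 Gh *.
      (* Completing the square around G = 1 / h with h = f + k. The bound h <= 2 produces the
         constant 2 in front of the error. *)
      have E : U x ^+ 2 * f x + k * U x ^+ 2 =
          2 * U x - G x + (G x - U x) ^+ 2 * (f x + k).
        have -> : (G x - U x) ^+ 2 * (f x + k) =
          G x * (G x * (f x + k)) - 2 * U x * (G x * (f x + k)) + U x ^+ 2 * (f x + k).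
          ring.
        rewrite Gh; ring.
      have : 0 <= k * U x ^+ 2 by rewrite mulr_ge0 ?sqr_ge0// ltW.
      have : (G x - U x) ^+ 2 * (f x + k) <= (G x - U x) ^+ 2 * 2.
        rewrite ler_wpM2l ?sqr_ge0//; lra.
      lra.
  rewrite (RintegralD measurableT (bint (bounded_mfunB b2U bG)) (bint b2GU)).
  rewrite (RintegralB measurableT (bint b2U) (bint bG)).
  rewrite (RintegralZl _ measurableT (bint bU)) (RintegralZl _ measurableT (bint bGU2)) -/g.
  move: GU; lra.
rewrite leNgt; apply/negP => pg1.
have gp : 0 < g.
  by rewrite lt_neqAle g0 andbT; apply: contraTneq pg1 => <-; rewrite mulr0 ltr10.
(* If p g > 1 then [K] is positive, while [key] bounds it by 2 p g t - 2 t + 2 eta^2, at most (2 p g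
   + 4) eta once eta <= 1; the final division by 2 in [eta] makes the contradiction strict. *)
pose K := p * g ^+ 2 - g.
have K0 : 0 < K by rewrite /K subr_gt0 expr2 mulrA ltr_pMl.
have c0 : 0 < 2 * (p * g) + 4 by rewrite addr_gt0// mulr_gt0// (lt_trans _ pg1).
pose eta := Num.min 1 (K / (2 * (p * g) + 4) / 2).
have eta0 : 0 < eta by rewrite lt_min ltr01 !divr_gt0.
have eta1 : eta <= 1 by rewrite ge_min lexx.
have etaK : eta * (2 * (p * g) + 4) < K.
  rewrite -ltr_pdivlMr//; apply: (@le_lt_trans _ _ (K / (2 * (p * g) + 4) / 2)).
    by rewrite ge_min lexx orbT.
  by rewrite ltr_pdivrMr// ltr_pMr ?divr_gt0// ltr1n.
have [t [t2 pt]] := key _ eta0.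
have tle : `|t| <= eta.
  have e0 : 0 <= eta := ltW eta0.
  by rewrite -ler_sqr ?nnegrE// real_normK ?num_real.
move: tle; rewrite ler_norml => /andP[t_1 t_2].
have pg0 : 0 <= p * g by rewrite mulr_ge0.
have : (p * g) * t <= (p * g) * eta by rewrite ler_wpM2l.
have : 0 <= p * t ^+ 2 by rewrite mulr_ge0 ?sqr_ge0.
have : eta ^+ 2 <= eta by rewrite expr2 ler_piMr// ltW.
have : p * (g - t) ^+ 2 = p * g ^+ 2 - 2 * ((p * g) * t) + p * t ^+ 2 by ring.
move: etaK pt; rewrite /K; lra.
Qed.

Lemma le_HM_of_trig (p : R) : 0 <= p ->
  (forall U, trig_poly U -> p * (\int[mu]_x U x) ^+ 2 <= \int[mu]_x (U x ^+ 2 * f x)) ->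
  (p%:E <= HM f)%E.
Proof.
move=> p0 pU; apply/(le_HM f01 p0).
move: (p0); rewrite le_eqVlt => /predU1P[<-|pp]; first by rewrite mul0e lee_fin ler01.
rewrite -lee_pdivlMl// mule1.
have := inv_mass_lim mf f01; apply: cvge_le; apply: nearW => n.
have bG : bounded_mfun (shifted_inv f n).
  split; first exact: measurable_shifted_inv.
  exists n.+1%:R => x; rewrite ger0_norm; last by rewrite invr_ge0 ltW// shift_gt0.
  rewrite /shifted_inv -[leRHS]invrK lef_pV2 ?posrE ?invr_gt0 ?ltr0n ?shift_gt0//.
  by rewrite lerDr; have /andP[] := f01 x.
have -> : (\int[mu]_x (shifted_inv f n x)%:E)%E = (\int[mu]_x shifted_inv f n x)%:E.
  by rewrite /Rintegral fineK//; apply: integrable_fin_num => //; exact: bint.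
by rewrite lee_fin -[p^-1]mul1r ler_pdivlMr// mulrC; exact: shifted_inv_bound.
Qed.

End extremal.

(** * The domination criterion *)

Section domination_criterion.
Context (R : realType) (d : nat).
Local Notation C := (complex R).
Local Notation T := (d.-tuple R).
Local Notation mu := (torus_measure R d).

(** The kernel depends only on differences of sites, so the first site can be moved to the
    origin. *)
Lemma kernel_mx_shift (f : T -> R) n (e : 'I_n.+1 -> 'rV[int]_d) :
  kernel_mx f e = kernel_mx f (ord_cons 0 (fun i => e (lift ord0 i) - e ord0)).
Proof.
have E i : ord_cons 0 (fun i => e (lift ord0 i) - e ord0) i = e i - e ord0.
  by case: (unliftP ord0 i) => [j ->|->]; rewrite ?ord_cons_lift ?ord_cons0 ?subrr.
by apply/matrixP => i j; rewrite !mxE !E opprB subrKA.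
Qed.

Lemma kernel_mx_ord_cons (f : T -> R) n k (e : 'I_n -> 'rV[int]_d) :
  row' ord0 (col' ord0 (kernel_mx f (ord_cons k e))) = kernel_mx f e.
Proof. by apply/matrixP => i j; rewrite !mxE !ord_cons_lift. Qed.

Section criterion.
Context (f : T -> R) (mf : measurable_fun setT f) (f01 : forall x, 0 <= f x <= 1).
Context (p : R) (p0 : 0 <= p).

Let bf := bounded_unit_range mf f01.

Lemma qform_kernel_mx_ge_HM n (e : 'I_n -> 'rV[int]_d) v : (p%:E <= HM f)%E ->
  injective e -> (forall i, e i != 0) ->
  p%:C%C * `|v ord0| ^+ 2 <= qform (kernel_mx f (ord_cons 0 e)) v.
Proof.
move=> pHM ei e0; rewrite qform_kernel_mx//; set S := trig_sum _ _.
have bS : bounded_cmfun S by exact: bounded_trig_sum.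
have v0 : v ord0 = cint mu S.
  rewrite cint_trig_sum (bigD1 ord0) ?ord_cons0//= big1 ?addr0// => j /andP[ej j0].
  case: (unliftP ord0 j) ej j0 => [i ->|->]; rewrite ?eqxx//.
  by rewrite ord_cons_lift (negbTE (e0 i)).
rewrite v0 -add_Re2_Im2 -rmorphM lecR mulrDr.
have pI := (le_HM f01 p0).1 pHM.
(* The real inequality is applied to the real and imaginary parts of S separately, and the two are
   added. *)
have [bR bI] := bS.
apply: le_trans (lerD (harmonic_cauchy_schwarz mf f01 p0 pI bR)
  (harmonic_cauchy_schwarz mf f01 p0 pI bI)) _.
have b2 (G : T -> R) : bounded_mfun G -> mu.-integrable setT (EFin \o (fun x => G x ^+ 2 * f x)).
  by move=> bG; apply: bounded_mfun_integrable; apply: bounded_mfunM => //; exact: bounded_mfunM.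
rewrite -(RintegralD measurableT (b2 _ bR) (b2 _ bI)).
rewrite le_eqVlt; apply/orP; left; apply/eqP; apply: eq_Rintegral => x _.
by rewrite /normsq; ring.
Qed.

Lemma det_cyl_mx_ge_HM n (e : 'I_n -> 'rV[int]_d) b : (p%:E <= HM f)%E ->
  injective e -> (forall i, e i != 0) ->
  p%:C%C * \det (cyl_mx b (kernel_mx f e)) <=
  \det (cyl_mx (ord_cons true b) (kernel_mx f (ord_cons 0 e))).
Proof.
move=> pHM ei e0.
rewrite -(kernel_mx_ord_cons f 0 e).
rewrite (_ : cyl_mx b _ = cyl_mx (ord_cons true b \o lift ord0)
   (row' ord0 (col' ord0 (kernel_mx f (ord_cons 0 e))))); last first.
  by apply/matrixP => i j; rewrite mxE [RHS]mxE /= ord_cons_lift.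
apply: det_cyl_mx_step => //.
- exact: kernel_mx_hermitian.
- by rewrite ord_cons0.
- by move=> v; exact: qform_kernel_mx_ge_HM.
- by move=> v; apply: qform_kernel_mx_le => //; exact: ord_cons_inj.
Qed.

Section converse.
Hypothesis pp : 0 < p.
Hypothesis det_step : forall n (e : 'I_n -> 'rV[int]_d), injective e ->
  (forall i, e i != 0) ->
  p%:C%C * \det (kernel_mx f e) <= \det (kernel_mx f (ord_cons 0 e)).

(* By translation invariance the hypothesis bounds the probability that n
   given sites are occupied below by p ^ n, so no Gram determinant vanishes. *)
Lemma det_kernel_mx_gt0 n (e : 'I_n -> 'rV[int]_d) : injective e ->
  0 < \det (kernel_mx f e).
Proof.
elim: n e => [|n IH] e ei; first by rewrite det_mx00 ltr01.
rewrite kernel_mx_shift.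
have ei' : injective (fun i => e (lift ord0 i) - e ord0).
  by move=> i j /addIr /ei /lift_inj.
apply: lt_le_trans (det_step ei' _); first by rewrite mulr_gt0 ?ltcR// IH.
by move=> i; rewrite subr_eq0 (inj_eq ei) eq_sym neq_lift.
Qed.

Lemma le_qform_kernel_mx n (e : 'I_n -> 'rV[int]_d) v : injective e ->
  (forall i, e i != 0) -> v ord0 = 1 ->
  p%:C%C <= qform (kernel_mx f (ord_cons 0 e)) v.
Proof.
move=> ei e0 v0; rewrite -(ler_pM2r (det_kernel_mx_gt0 ei)).
apply: le_trans (det_step ei e0) _.
rewrite -[in leRHS](kernel_mx_ord_cons f 0 e); apply: det_le_qform => //.
  exact: kernel_mx_hermitian.
by move=> u; exact: qform_kernel_mx_ge0.
Qed.

Lemma trig_poly_sum (U : T -> R) : trig_poly U ->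
  exists n (e : 'I_n -> 'rV[int]_d) v, [/\ injective e, forall i, e i != 0 &
    forall x, trig_sum (ord_cons 0 e) v x = (U x)%:C%C].
Proof.
(* [r] lists the distinct nonzero frequencies. The origin is always put in front; if it does not
   occur in [s], its coefficient is an empty sum. *)
move=> [s Us]; pose r := [seq k <- undup (map snd s) | k != 0].
pose e (i : 'I_(size r)) := nth 0 r i.
have ei : injective e.
  by move=> i j /eqP; rewrite nth_uniq ?filter_uniq ?undup_uniq// => /eqP /val_inj.
have e0 i : e i != 0.
  have : e i \in r by exact: mem_nth.
  by rewrite mem_filter => /andP[].
exists (size r), e, (fun j => \sum_(u <- s | u.2 == ord_cons 0 e j) u.1); split => // x.
rewrite Us /trig_sum.
under eq_bigr do rewrite mulr_suml big_mkcond /=.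
rewrite exchange_big /= big_seq [RHS]big_seq; apply: eq_bigr => u us.
have [j ju] : exists j, ord_cons 0 e j = u.2.
  have [u0|u0] := eqVneq u.2 0; first by exists ord0; rewrite ord_cons0.
  have ur : u.2 \in r by rewrite mem_filter u0 mem_undup map_f.
  have ui : (index u.2 r < size r)%N by rewrite index_mem.
  by exists (lift ord0 (Ordinal ui)); rewrite ord_cons_lift /e /= nth_index.
rewrite -big_mkcond (big_pred1 j) /= ?ju// => k.
by rewrite eq_sym -ju (inj_eq (ord_cons_inj ei e0)).
Qed.

Lemma trig_poly_ineq (U : T -> R) : trig_poly U ->
  p * (\int[mu]_x U x) ^+ 2 <= \int[mu]_x (U x ^+ 2 * f x).
Proof.
move=> tU; set c := \int[mu]_x U x.
have bU := bounded_trig_poly tU.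
have bU2f : bounded_mfun (fun x => U x ^+ 2 * f x).
  by apply: bounded_mfunM => //; exact: bounded_mfunM.
(* Both sides are quadratic in U, so a nonzero mean is normalised to 1, which makes the coefficient
   at the origin 1. *)
have [c0|c0] := eqVneq c 0.
  rewrite c0 expr0n mulr0; apply: Rintegral_ge0 => x _.
  by rewrite mulr_ge0 ?sqr_ge0//; have /andP[] := f01 x.
have [n [e [v [ei e0 vU]]]] :=
  trig_poly_sum (trig_polyM (trig_poly_cst d c^-1) tU).
have v0 : v ord0 = 1.
  transitivity (cint mu (trig_sum (ord_cons 0 e) v)).
    rewrite cint_trig_sum (bigD1 ord0) ?ord_cons0//= big1 ?addr0// => j /andP[ej j0].
    case: (unliftP ord0 j) ej j0 => [i ->|->]; rewrite ?eqxx//.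
    by rewrite ord_cons_lift (negbTE (e0 i)).
  rewrite (_ : trig_sum _ _ = fun x => (c^-1 * U x)%:C%C); last exact/funext.
  rewrite cint_real RintegralZl//; last exact: bounded_mfun_integrable.
  by rewrite mulVf.
have := le_qform_kernel_mx ei e0 v0; rewrite qform_kernel_mx// lecR.
rewrite (_ : \int[mu]_x _ = c ^- 2 * \int[mu]_x (U x ^+ 2 * f x)).
  by rewrite mulrC ler_pdivlMr// exprn_even_gt0.
rewrite -RintegralZl//; last exact: bounded_mfun_integrable.
apply: eq_Rintegral => x _; rewrite vU /normsq /= expr0n addr0 exprMn exprVn.
ring.
Qed.

End converse.

Lemma domination_criterion :
  (forall n (e : 'I_n -> 'rV[int]_d) b, injective e -> (forall i, e i != 0) ->
    p%:C%C * \det (cyl_mx b (kernel_mx f e)) <=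
    \det (cyl_mx (ord_cons true b) (kernel_mx f (ord_cons 0 e)))) <->
  (p%:E <= HM f)%E.
Proof.
split=> [h|pHM n e b ei e0]; last exact: det_cyl_mx_ge_HM.
apply: le_HM_of_trig => // U tU.
(* The case p = 0 is treated apart, since positivity of the Gram determinants rests on p > 0. *)
move: (p0); rewrite le_eqVlt => /predU1P[<-|pp].
  rewrite mul0r; apply: Rintegral_ge0 => x _.
  by rewrite mulr_ge0 ?sqr_ge0//; have /andP[] := f01 x.
apply: trig_poly_ineq tU => // n e ei e0.
have cylT m (b : 'I_m -> bool) (K : 'M[C]_m) : (forall i, b i) -> cyl_mx b K = K.
  by move=> bT; apply/matrixP => i j; rewrite mxE bT.
have := h n e xpredT ei e0; rewrite !cylT// => i.
by case: (unliftP ord0 i) => [j ->|->]; rewrite ?ord_cons_lift ?ord_cons0.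
Qed.

End criterion.
End domination_criterion.

Lemma cyl_mx_flip (R : realType) d (f : d.-tuple R -> R) n (e : 'I_n -> 'rV[int]_d) b :
  bounded_mfun f -> injective e ->
  cyl_mx b (kernel_mx (fun x => 1 - f x) e) = cyl_mx (negb \o b) (kernel_mx f e).
Proof.
move=> bf ei; apply/matrixP => i j; rewrite mxE [RHS]mxE kernel_mx1B//=.
by case: (b i) => //=; rewrite opprB addrC subrK.
Qed.

(** * Translation between probabilities and determinants *)

Section cylinder_inequalities.
Context (R : realType) (d : nat) (f : d.-tuple R -> R) (P : probability (config d) R).
Context (mf : measurable_fun setT f) (f01 : forall x, 0 <= f x <= 1).
Hypothesis dP : is_determinantal f P.

Let fin n (e : 'I_n -> 'rV[int]_d) b : P (cylinder e b) \is a fin_num.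
Proof. by apply: fin_num_measure; exact: measurable_cylinder. Qed.

Lemma le_cylinder_occupied n (e : 'I_n -> 'rV[int]_d) b (p : R) :
  injective e -> (forall i, e i != 0) ->
  (p%:E * P (cylinder e b) <= P (occupied 0 `&` cylinder e b))%E <->
  p%:C%C * \det (cyl_mx b (kernel_mx f e)) <=
  \det (cyl_mx (ord_cons true b) (kernel_mx f (ord_cons 0 e))).
Proof.
move=> ei e0; rewrite -!(prob_cylinder _ dP)//; last exact: ord_cons_inj.
rewrite -rmorphM /= lecR.
have -> : occupied 0 `&` cylinder e b = cylinder (ord_cons 0 e) (ord_cons true b).
  by rewrite cylinder_ord_cons.
by rewrite -lee_fin EFinM !fineK.
Qed.

Lemma ge_cylinder_occupied n (e : 'I_n -> 'rV[int]_d) b (q : R) :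
  injective e -> (forall i, e i != 0) ->
  (P (occupied 0 `&` cylinder e b) <= q%:E * P (cylinder e b))%E <->
  (1 - q)%:C%C * \det (cyl_mx (negb \o b) (kernel_mx (fun x => 1 - f x) e)) <=
  \det (cyl_mx (ord_cons true (negb \o b)) (kernel_mx (fun x => 1 - f x) (ord_cons 0 e))).
Proof.
move=> ei e0; have bf := bounded_unit_range mf f01.
have ei' := ord_cons_inj ei e0.
rewrite !cyl_mx_flip//.
rewrite (_ : negb \o (negb \o b) = b); last by apply/funext => i /=; rewrite negbK.
rewrite (_ : negb \o ord_cons true (negb \o b) = ord_cons false b); last first.
  apply/funext => i /=; case: (unliftP ord0 i) => [j ->|->].
    by rewrite !ord_cons_lift /= negbK.
  by rewrite !ord_cons0.
rewrite -!(prob_cylinder _ dP)// -rmorphM /= lecR.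
(* Splitting by the value at the origin turns the upper bound q on the occupied part into the lower
   bound 1 - q on the vacant part. *)
have split : P (cylinder e b) = (P (cylinder (ord_cons 0%R e) (ord_cons true b)) +
    P (cylinder (ord_cons 0%R e) (ord_cons false b)))%E.
  rewrite -measureU//; try exact: measurable_cylinder.
    rewrite !cylinder_ord_cons -setIUl; congr (P _).
    apply/seteqP; split=> eta; [move=> ?|by case].
    by split => //=; case: (eta _); [left|right].
  rewrite -subset0 => eta [h1 h2]; have := h1 ord0; rewrite (h2 ord0).
  by rewrite !ord_cons0.
have -> : occupied 0 `&` cylinder e b = cylinder (ord_cons 0 e) (ord_cons true b).
  by rewrite cylinder_ord_cons.
rewrite split fineD// -(fineK (fin (ord_cons 0 e) (ord_cons true b))).
rewrite -(fineK (fin (ord_cons 0 e) (ord_cons false b))) -EFinD -EFinM lee_fin /=.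
by split; lra.
Qed.

End cylinder_inequalities.

Theorem theorem5p16 (R : realType) (d : nat) (f : d.-tuple R -> R)
    (Pf : probability (config d) R) (p q : R)
    (hd : (1 <= d)%N)
    (mf : measurable_fun [set: d.-tuple R] f)
    (perf : Zd_periodic f)
    (f01 : forall x, 0 <= f x <= 1)
    (hPf : is_determinantal f Pf)
    (hp : 0 <= p <= 1) (hq : 0 <= q <= 1) :
  (full_dom_by_product p Pf <-> (p%:E <= HM f)%E) /\
  (full_dom_product Pf q <->
    (1 - HM (fun x => 1 - f x)%R <= q%:E)%E).
Proof.
have mf' : measurable_fun setT (fun x => 1 - f x) by exact: measurable_funB.
have f01' x : 0 <= 1 - f x <= 1 by have := f01 x; lra.
have p0 : 0 <= p by case/andP: hp.
have q0 : 0 <= 1 - q by rewrite subr_ge0; case/andP: hq.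
split.
  apply: iff_trans (full_dom_by_productP Pf hp) _.
  apply: iff_trans (domination_criterion mf f01 p0).
  by split=> h n e b ei e0; apply/(le_cylinder_occupied hPf) => //; exact: h.
apply: iff_trans (full_dom_productP Pf hq) _.
(* The rearrangement is checked for infinite values as well, where extended subtraction is not
   cancellative. *)
have -> : (1 - HM (fun x => (1 - f x)%R) <= q%:E)%E =
    ((1 - q)%:E <= HM (fun x => (1 - f x)%R))%E.
  case: (HM _) => [r| |] /=; rewrite ?leey ?leNye//.
  by rewrite -EFinB !lee_fin; apply/idP/idP; lra.
apply: iff_trans (domination_criterion mf' f01' q0).
split=> h n e b ei e0.
  (* Every pattern is the negation of another, so the inequalities for flipped patterns cover all
     patterns. *)
  rewrite (_ : b = negb \o (negb \o b)); last by apply/funext => i /=; rewrite negbK.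
  by apply/(ge_cylinder_occupied mf f01 hPf) => //; exact: h.
by apply/(ge_cylinder_occupied mf f01 hPf) => //; exact: h.
Qed.
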